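(* For every Banach lattice $X$, the Banach lattice $C[0,1]$ is linearly embeddable into $X$ if and only if $C[0,1]$ is lattice embeddable into $X$.
   Context: Banach lattices are real. An operator is a bounded linear map. $C[0,1]$ is the Banach lattice of continuous real-valued functions on $[0,1]$ with the supremum norm and pointwise order. An operator $T\colon X\to Y$ between Banach lattices is a lattice homomorphism if $T(x\vee y)=Tx\vee Ty$ and $T(x\wedge y)=Tx\wedge Ty$ for all $x,y\in X$. A Banach space $X$ is linearly embeddable into a Banach space $Y$ if there is an operator $T\colon X\to Y$ which is a (linear, not necessarily isometric) isomorphism onto its range. If $X$ and $Y$ are Banach lattices and such a $T$ can be chosen to be also a lattice homomorphism, then $X$ is said to be lattice embeddable into $Y$. *)

(* Defs.v *)
From HB Require Import structures.
From mathcomp Require Import all_boot all_order all_algebra.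
From mathcomp Require Import all_classical all_reals all_analysis.
From mathcomp Require Import ring lra.

Set Implicit Arguments.
Unset Strict Implicit.
Unset Printing Implicit Defensive.

Import Order.TTheory GRing.Theory Num.Theory.
Import numFieldNormedType.Exports.

Local Open Scope classical_set_scope.
Local Open Scope ring_scope.

(* The lattice operations are fields of their own, with the axioms of
   [Order.isPOrder], [Order.POrder_isMeetSemilattice] and
   [Order.POrder_isJoinSemilattice]: Hierarchy Builder rejects a join of
   [GRing.Lmodule] with [Order.Lattice], because the only common descendants of
   additive groups and orders in MathComp are the [Num] structures. *)
HB.mixin Record Lmodule_isVectorLattice (R : realType) V
    & GRing.Lmodule R V := {
  vle : rel V ;
  vmeet : V -> V -> V ;
  vjoin : V -> V -> V ;
  vle_refl : reflexive vle ;
  vle_anti : antisymmetric vle ;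
  vle_trans : transitive vle ;
  vlexI : forall x y z, vle x (vmeet y z) = vle x y && vle x z ;
  vleUx : forall x y z, vle (vjoin x y) z = vle x z && vle y z ;
  vleD2r : forall z x y, vle x y -> vle (x + z) (y + z) ;
  vleZ2l : forall (a : R) x y, 0 <= a -> vle x y -> vle (a *: x) (a *: y)
}.

#[short(type="vectorLatticeType")]
HB.structure Definition VectorLattice (R : realType) :=
  { V of GRing.Lmodule R V & Lmodule_isVectorLattice R V }.

(* The modulus of the lattice; [`|x|] denotes the norm. *)
Definition modulus (R : realType) (V : vectorLatticeType R) (x : V) : V :=
  vjoin x (- x).

HB.mixin Record VectorLattice_isBanachLattice (R : realType) V
    & CompleteNormedModule R V & VectorLattice R V := {
  le_norm_modulus :
    forall x y : V, vle (modulus x) (modulus y) -> `|x| <= `|y| :> R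
}.

#[short(type="banachLatticeType")]
HB.structure Definition BanachLattice (R : realType) :=
  { V of CompleteNormedModule R V & VectorLattice R V
       & VectorLattice_isBanachLattice R V }.

Section Embeddings.
Variable R : realType.

Definition bounded_operator (X Y : normedModType R) (T : X -> Y) :=
  exists M : R, forall x, `|T x| <= M * `|x|.

(* The inverse of [T] on its range is represented by a function on [Y] whose
   values outside [range T] are irrelevant; it is automatically linear there. *)
Definition isomorphism_onto_range (X Y : normedModType R) (T : X -> Y) :=
  exists2 S : Y -> X, cancel T S &
    exists M : R, forall y, range T y -> `|S y| <= M * `|y|.

Definition lattice_homomorphism (X Y : vectorLatticeType R) (T : X -> Y) :=
  {morph T : x y / vjoin x y} /\ {morph T : x y / vmeet x y}.

Definition linearly_embeddable (X Y : completeNormedModType R) :=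
  exists T : {linear X -> Y},
    bounded_operator T /\ isomorphism_onto_range T.

Definition lattice_embeddable (X Y : banachLatticeType R) :=
  exists T : {linear X -> Y},
    [/\ bounded_operator T, isomorphism_onto_range T & lattice_homomorphism T].

End Embeddings.

Definition unit_itv (R : realType) : Type := set_type (`[0, 1]%classic : set R).
HB.instance Definition _ (R : realType) :=
  Topological.copy (unit_itv R) (set_type (`[0, 1]%classic : set R)).

(* [C01 R] is an alias of [continuousType], which already carries the
   compact-open topology: the alias is given the norm topology instead. *)
Definition C01 (R : realType) : Type := continuousType (unit_itv R) R.
HB.instance Definition _ (R : realType) :=
  Choice.copy (C01 R) (continuousType (unit_itv R) R).

Section C01.
Variable R : realType.
Local Notation I := (unit_itv R).
Local Notation C := (C01 R).
Implicit Types f g h : C.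

Definition C01_of (f : I -> R) (cf : continuous f) : C := mkcts cf.

Lemma C01_cts f : continuous (f : I -> R).
Proof. exact: (@cts_fun _ _ (f : continuousType I R)). Qed.

Lemma C01P f g : (forall t, f t = g t) -> f = g.
Proof. by move=> fg; apply/continuousEP. Qed.

Lemma unit_itv_nonempty : I.
Proof. by exists 0; rewrite inE /= in_itv /= lexx ler01. Qed.

Lemma C01_zero_subproof : continuous (fun _ : I => 0 : R).
Proof. by move=> t; exact: cst_continuous. Qed.
Lemma C01_opp_subproof f : continuous (fun t : I => - f t).
Proof. by move=> t; exact/continuousN/C01_cts. Qed.
Lemma C01_add_subproof f g : continuous (fun t : I => f t + g t).
Proof. by move=> t; exact: (continuousD (@C01_cts _ t) (@C01_cts _ t)). Qed.
Lemma C01_scale_subproof (a : R) f : continuous (fun t : I => a * f t).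
Proof. by move=> t; exact: (cvgMr (@C01_cts _ t)). Qed.
Lemma C01_join_subproof f g : continuous (fun t : I => Num.max (f t) (g t)).
Proof. by move=> t; exact: (continuous_max (@C01_cts _ t) (@C01_cts _ t)). Qed.
Lemma C01_meet_subproof f g : continuous (fun t : I => Num.min (f t) (g t)).
Proof. by move=> t; exact: (continuous_min (@C01_cts _ t) (@C01_cts _ t)). Qed.

Definition C01_zero : C := C01_of (@C01_zero_subproof).
Definition C01_opp f : C := C01_of (@C01_opp_subproof f).
Definition C01_add f g : C := C01_of (@C01_add_subproof f g).
Definition C01_scale (a : R) f : C := C01_of (@C01_scale_subproof a f).
Definition C01_join f g : C := C01_of (@C01_join_subproof f g).
Definition C01_meet f g : C := C01_of (@C01_meet_subproof f g).

Lemma C01_addA : associative C01_add.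
Proof. by move=> f g h; apply: C01P => t; exact: addrA. Qed.
Lemma C01_addC : commutative C01_add.
Proof. by move=> f g; apply: C01P => t; exact: addrC. Qed.
Lemma C01_add0 : left_id C01_zero C01_add.
Proof. by move=> f; apply: C01P => t; exact: add0r. Qed.
Lemma C01_addN : left_inverse C01_zero C01_opp C01_add.
Proof. by move=> f; apply: C01P => t; exact: addNr. Qed.

HB.instance Definition _ :=
  GRing.isZmodule.Build C C01_addA C01_addC C01_add0 C01_addN.

Lemma C01_scaleA a b f : C01_scale a (C01_scale b f) = C01_scale (a * b) f.
Proof. by apply: C01P => t; exact: mulrA. Qed.
Lemma C01_scale1 : left_id 1 C01_scale.
Proof. by move=> f; apply: C01P => t; exact: mul1r. Qed.
Lemma C01_scaleDr : right_distributive C01_scale +%R.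
Proof. by move=> a f g; apply: C01P => t; exact: mulrDr. Qed.
Lemma C01_scaleDl f : {morph C01_scale^~ f : a b / a + b}.
Proof. by move=> a b; apply: C01P => t; exact: mulrDl. Qed.

HB.instance Definition _ := GRing.Zmodule_isLmodule.Build R C
  C01_scaleA C01_scale1 C01_scaleDr C01_scaleDl.

Definition C01_norm f : R := sup (range (fun t : I => `|f t|)).

Lemma C01_range_ubound f : has_ubound (range (fun t : I => `|f t|)).
Proof.
have cf : {within `[0, 1], continuous (valL_ 0 (f : I -> R))}.
  by apply/subspace_valL_continuousP'; exact: C01_cts.
have [M [_ fM]] :=
  compact_bounded (continuous_compact cf (@segment_compact _ 0 1)).
exists (M + 1) => _ [t _ <-].
have := fM (M + 1); rewrite ltrDl ltr01 => /(_ isT); apply.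
exists (val t); first exact: set_valP.
by have := congr1 (@^~ t) (valLK 0 (f : I -> R)); rewrite /sigL.
Qed.

Lemma C01_norm_ge f t : `|f t| <= C01_norm f.
Proof. by apply: ub_le_sup; [exact: C01_range_ubound | exists t]. Qed.

Lemma C01_norm_le f (M : R) : (forall t, `|f t| <= M) -> C01_norm f <= M.
Proof.
move=> fM; apply: ge_sup => [|_ [t _ <-]]; last exact: fM.
by exists `|f unit_itv_nonempty|; exists unit_itv_nonempty.
Qed.

Lemma C01_normD f g : C01_norm (f + g) <= C01_norm f + C01_norm g.
Proof.
apply: C01_norm_le => t; apply: (le_trans (ler_normD _ _)).
by apply: lerD; exact: C01_norm_ge.
Qed.

Lemma C01_norm_ge0 f : 0 <= C01_norm f.
Proof. exact: le_trans (C01_norm_ge f unit_itv_nonempty). Qed.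

Lemma C01_normZ (a : R) f : C01_norm (a *: f) = `|a| * C01_norm f.
Proof.
have le_normZ b g : C01_norm (b *: g) <= `|b| * C01_norm g.
  apply: C01_norm_le => t; rewrite normrM.
  by apply: ler_wpM2l => //; exact: C01_norm_ge.
apply/eqP; rewrite eq_le le_normZ /=.
have [->|a0] := eqVneq a 0; first by rewrite normr0 mul0r C01_norm_ge0.
rewrite -ler_pdivlMl ?normr_gt0// -normfV.
by rewrite -{1}[f](scalerK a0) le_normZ.
Qed.

Lemma C01_norm0_eq0 f : C01_norm f = 0 -> f = 0.
Proof.
move=> f0; apply: C01P => t; apply/normr0_eq0/eqP.
by rewrite -normr_le0 normr_id -f0 C01_norm_ge.
Qed.

HB.instance Definition _ :=
  Lmodule_isNormed.Build R C C01_normD C01_normZ C01_norm0_eq0.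

Lemma C01_complete (F : set_system C) : ProperFilter F -> cauchy F -> cvg F.
Proof.
move=> FF /cauchy_ballP Fc.
have Fnear (e : R) : 0 < e ->
    exists2 A, F A & forall f g, A f -> A g -> `|f - g| < e.
  move=> /Fc[[A B] /= [FA FB] AB]; exists (A `&` B); first exact: filterI.
  by move=> f g [Af _] [_ Bg]; have := AB (f, g) (conj Af Bg); rewrite -ball_normE.
have Ft t : cvg ((fun f : C => f t : R) @ F).
  apply/cauchy_cvgP/cauchy_exP => e /Fnear[A FA Ae].
  have [f Af] := filter_ex FA; exists (f t).
  apply: (@filterS _ F _ A) FA => g Ag; rewrite /= -ball_normE /=.
  have /le_lt_trans := C01_norm_ge (f - g) t; apply; exact: Ae.
pose l (t : I) : R := lim ((fun f : C => f t : R) @ F).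
have Fl (e : R) : 0 < e -> F [set f : C | forall t, `|l t - f t| <= e].
  move=> /Fnear[A FA Ae]; apply: filterS (FA) => f Af t.
  apply: (@cvgr_to_le _ F _ R (fun g : C => `|g t - f t|)).
    by apply: cvg_norm; apply: cvgB; [exact: Ft | exact: cvg_cst].
  apply: (@filterS _ F _ A) FA => g Ag; apply: ltW.
  by have /le_lt_trans := C01_norm_ge (g - f) t; apply; exact: Ae.
have lc : continuous l.
  move=> t; apply/(cvgrPdist_le (FF := nbhs_filter t)) => e e0.
  have e3 : 0 < e / 3 by rewrite divr_gt0.
  have [f fl] := filter_ex (Fl _ e3).
  have /(cvgrPdist_le (FF := nbhs_filter t))/(_ _ e3) := @C01_cts f t.
  apply: filterS => s fts.
  rewrite (_ : l t - l s = (l t - f t) + (f t - f s) + (f s - l s)); last by ring.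
  rewrite (_ : e = e / 3 + e / 3 + e / 3); last by field.
  apply: (le_trans (ler_normD _ _)); apply: lerD; last by rewrite distrC.
  by apply: (le_trans (ler_normD _ _)); apply: lerD.
apply/cvg_ex; exists (C01_of lc); apply/cvgrPdist_le => e /Fl.
by apply: filterS => f fl; exact: C01_norm_le.
Qed.

HB.instance Definition _ := Uniform_isComplete.Build C C01_complete.

Definition C01_le : rel C := fun f g => `[< forall t, f t <= g t >].

Lemma C01_le_refl : reflexive C01_le.
Proof. by move=> f; apply/asboolP. Qed.
Lemma C01_le_anti : antisymmetric C01_le.
Proof.
move=> f g /andP[/asboolP fg /asboolP gf]; apply: C01P => t.
by apply/le_anti; rewrite fg gf.
Qed.
Lemma C01_le_trans : transitive C01_le.
Proof.
move=> g f h /asboolP fg /asboolP gh; apply/asboolP => t.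
exact: le_trans (gh t).
Qed.
Lemma C01_lexI f g h : C01_le f (C01_meet g h) = C01_le f g && C01_le f h.
Proof.
apply/asboolP/andP => [fgh|[/asboolP fg /asboolP fh] t]; last first.
  by rewrite /= le_min fg fh.
by split; apply/asboolP => t; move: (fgh t); rewrite /= le_min => /andP[].
Qed.
Lemma C01_leUx f g h : C01_le (C01_join f g) h = C01_le f h && C01_le g h.
Proof.
apply/asboolP/andP => [fgh|[/asboolP fg /asboolP fh] t]; last first.
  by rewrite /= ge_max fg fh.
by split; apply/asboolP => t; move: (fgh t); rewrite /= ge_max => /andP[].
Qed.
Lemma C01_leD2r h f g : C01_le f g -> C01_le (f + h) (g + h).
Proof. by move=> /asboolP fg; apply/asboolP => t; exact: lerD. Qed.
Lemma C01_leZ2l (a : R) f g : 0 <= a -> C01_le f g -> C01_le (a *: f) (a *: g).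
Proof.
by move=> a0 /asboolP fg; apply/asboolP => t; exact: ler_wpM2l.
Qed.

HB.instance Definition _ := Lmodule_isVectorLattice.Build R C
  C01_le_refl C01_le_anti C01_le_trans C01_lexI C01_leUx C01_leD2r C01_leZ2l.

Lemma C01_le_norm_modulus f g :
  vle (modulus f) (modulus g) -> `|f| <= `|g| :> R.
Proof.
move=> /asboolP fg; apply: C01_norm_le => t.
apply: le_trans (C01_norm_ge g t).
have maxN (x : R) : Num.max x (- x) = `|x|.
  have [x0|x0] := leP 0 x.
    by rewrite max_l ?ger0_norm// ge0_cp.
  by rewrite max_r ?ltr0_norm// ltW// (lt_trans x0)// oppr_gt0.
by rewrite -!maxN; exact: fg.
Qed.

HB.instance Definition _ :=
  VectorLattice_isBanachLattice.Build R C C01_le_norm_modulus.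

End C01.

(* Main.v *)
(** Let [T : C[0,1] -> X] be a linear embedding and let [f_s] be bump functions
    indexed by the binary tree. Choose [e >= 0] in [X] such that the ideal [X_e]
    contains every [T f_s]. For each branch [t], Hahn-Banach gives a positive
    functional [s_t] on [X_e], dominated by the norm, which is bounded below by
    [m > 0] on every [|T f_(t|n)|].

    Averaging over signs and Khintchine's inequality show that a positive
    functional sees [T f_(t|n)] as a Cauchy sequence in [n], and that, for all but
    countably many [t], it sees that sequence get small. Call [h] in [X_e] big if
    [lim inf_n s_t (h /\ |T f_(t|n)|) > m / 4] for uncountably many [t]. Comparing
    [s_t] with [s_t'] for two suitable branches, a big element is split into two
    disjoint big elements, chosen among countably many candidates. Big elements
    have norm at least [m / 4], so this produces a binary tree of disjoint
    elements of norm bounded below, with room between the levels. Reading off the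
    binary digits along the tree gives [x] with [0 <= x <= E], for a multiple [E]
    of [e], and [h |-> h(x)] (functional calculus relative to [E]) is the required
    lattice embedding.

    Lattice identities in [X_e] are checked pointwise on real lattice
    homomorphisms (Kakutani); these, like [s_t], are obtained as minimal
    sublinear functionals. *)

Require Import Defs.
From mathcomp Require Import all_boot all_order all_algebra.
From mathcomp Require Import all_classical all_reals all_analysis.
From HB Require Import structures.
From mathcomp Require Import ring lra.

Set Implicit Arguments.
Unset Strict Implicit.
Unset Printing Implicit Defensive.

Import Order.TTheory GRing.Theory Num.Theory.
Import numFieldNormedType.Exports.

Local Open Scope classical_set_scope.
Local Open Scope ring_scope.

(** * Vector lattices *)

Section VectorLatticeTheory.
Variables (R : realType) (V : vectorLatticeType R).
Implicit Types (x y z : V) (a : R).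

Lemma vle_joinl x y : vle x (vjoin x y).
Proof. by have := vleUx x y (vjoin x y); rewrite vle_refl => /esym/andP[]. Qed.

Lemma vle_joinr x y : vle y (vjoin x y).
Proof. by have := vleUx x y (vjoin x y); rewrite vle_refl => /esym/andP[]. Qed.

Lemma vle_meetl x y : vle (vmeet x y) x.
Proof. by have := vlexI (vmeet x y) x y; rewrite vle_refl => /esym/andP[]. Qed.

Lemma vle_meetr x y : vle (vmeet x y) y.
Proof. by have := vlexI (vmeet x y) x y; rewrite vle_refl => /esym/andP[]. Qed.

Lemma vle_add2r z x y : vle (x + z) (y + z) = vle x y.
Proof.
apply/idP/idP; last exact: vleD2r.
by move=> /(vleD2r (- z)); rewrite !addrK.
Qed.

Lemma vsubr_ge0 x y : vle 0 (y - x) = vle x y.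
Proof. by rewrite -(vle_add2r x) add0r subrK. Qed.

Lemma vleN2 x y : vle (- x) (- y) = vle y x.
Proof. by rewrite -vsubr_ge0 opprK addrC vsubr_ge0. Qed.

Lemma vleD x y z t : vle x y -> vle z t -> vle (x + z) (y + t).
Proof.
move=> xy zt; apply: (@vle_trans _ _ (y + z)); first by rewrite vle_add2r.
by rewrite ![y + _]addrC vle_add2r.
Qed.

Lemma vmeetE x y : vmeet x y = - vjoin (- x) (- y).
Proof.
apply: vle_anti; apply/andP; split.
  by rewrite -vleN2 opprK vleUx !vleN2 vle_meetl vle_meetr.
by rewrite vlexI -vleN2 opprK vle_joinl/= -vleN2 opprK vle_joinr.
Qed.

Lemma vle_subr_addr x y z : vle x (y - z) = vle (x + z) y.
Proof. by rewrite -(vle_add2r z) subrK. Qed.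

Lemma vjoinDr x y z : vjoin x y + z = vjoin (x + z) (y + z).
Proof.
apply: vle_anti; apply/andP; split.
  by rewrite -vle_subr_addr vleUx !vle_subr_addr vle_joinl vle_joinr.
by rewrite vleUx !vle_add2r vle_joinl vle_joinr.
Qed.

Lemma vscaler_ge0 a x : 0 <= a -> vle 0 x -> vle 0 (a *: x).
Proof. by move=> a0 x0; have := vleZ2l a _ _ a0 x0; rewrite scaler0. Qed.

Lemma modulus_ge0 x : vle 0 (modulus x).
Proof.
have h : vle (x + - x) (modulus x + modulus x).
  by apply: vleD; rewrite ?vle_joinl ?vle_joinr.
have := vleZ2l (2^-1 : R) _ _ _ h; rewrite invr_ge0 ler0n => /(_ isT).
rewrite subrr scaler0 -[X in X + X]scale1r -scalerDl scalerA.
by rewrite mulVf ?scale1r.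
Qed.

Lemma modulus_le x y : vle (modulus x) y = vle x y && vle (- x) y.
Proof. exact: vleUx. Qed.

Lemma vle_modulus x : vle x (modulus x). Proof. exact: vle_joinl. Qed.

Lemma vleN_modulus x : vle (- x) (modulus x). Proof. exact: vle_joinr. Qed.

Lemma modulusN x : modulus (- x) = modulus x.
Proof.
have h y : vle (modulus (- y)) (modulus y).
  by rewrite modulus_le opprK vleN_modulus vle_modulus.
by apply: vle_anti; rewrite h/= -{1}(opprK x) h.
Qed.

Lemma modulus_id x : vle 0 x -> modulus x = x.
Proof.
move=> x0; apply: vle_anti; rewrite vle_modulus modulus_le vle_refl/=.
by rewrite (@vle_trans _ _ 0) // -vleN2 oppr0 opprK.
Qed.

Lemma modulusD x y : vle (modulus (x + y)) (modulus x + modulus y).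
Proof.
by rewrite modulus_le opprD !vleD ?vle_modulus ?vleN_modulus.
Qed.

Lemma modulusZ_le a x : vle (modulus (a *: x)) (`|a| *: modulus x).
Proof.
have [a0|a0] := leP 0 a.
  by rewrite ger0_norm// modulus_le -scalerN !vleZ2l ?vle_modulus ?vleN_modulus.
rewrite ltr0_norm// -modulusN -scaleNr modulus_le -scalerN.
by rewrite !vleZ2l ?vle_modulus ?vleN_modulus// oppr_ge0 ltW.
Qed.

End VectorLatticeTheory.

(** * Minimal sublinear functionals and real lattice homomorphisms *)

Section Sublinear.
Variables (R : realType) (V : lmodType R).
Implicit Types (q : V -> R) (x y z a : V).

Definition sublinear q :=
  (forall x y, q (x + y) <= q x + q y) /\
  (forall (c : R) x, 0 <= c -> q (c *: x) = c * q x).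

(* [z = vjoin x y] gives the lattice homomorphisms, the empty relation the plain
   Hahn-Banach theorem. *)
Variable P : V -> V -> V -> Prop.
Hypothesis P_shift : forall x y z w, P x y z -> P (x + w) (y + w) (z + w).

Definition submax q := forall x y z, P x y z -> q z <= Num.max (q x) (q y).

Definition subfun q := sublinear q /\ submax q.

Lemma sublinear0 q : sublinear q -> q 0 = 0.
Proof. by move=> [_ qZ]; have := qZ 0 0 (lexx _); rewrite scaler0 mul0r. Qed.

Lemma sublinearN q x : sublinear q -> - q (- x) <= q x.
Proof.
move=> ql; have := ql.1 x (- x).
by rewrite subrr sublinear0// addrC -lerBlDl sub0r.
Qed.

Section Shift.
Variables (q : V -> R) (a : V).
Hypothesis qP : subfun q.

Let E x := [set q (x + t *: a) - t * q a | t in [set t : R | 0 <= t]].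

(** The perturbation behind the sublinear proof of Hahn-Banach: it stays below [q] and pushes the
    value at [- a] down to at most [- q a]. *)
Definition shiftfun x := inf (E x).

Let E_lb x : has_lbound (E x).
Proof.
exists (- q (- x)) => _ [t /= t0 <-].
have := qP.1.1 (x + t *: a) (- x).
rewrite addrAC subrr add0r (qP.1.2 t a t0); lra.
Qed.

Let E_inf x : has_inf (E x).
Proof. by split => //; exists (q (x + 0 *: a) - 0 * q a), 0 => /=. Qed.

Let shift_le x t : 0 <= t -> shiftfun x <= q (x + t *: a) - t * q a.
Proof. by move=> t0; apply: ge_inf => //; exists t. Qed.

Let shift_near x (e : R) : 0 < e -> exists2 t, 0 <= t &
  q (x + t *: a) - t * q a < shiftfun x + e.
Proof. by move=> e0; have [_ [t t0 <-] te] := inf_adherent e0 (E_inf x); exists t. Qed.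

(** Since the expression under the infimum decreases in the parameter, near-minimizers [t] at [x]
    and [s] at [y] can both be replaced by [t + s]; [submax] needs one common shift for both
    arguments. *)
Let shift_anti x t s : 0 <= t -> 0 <= s ->
  q (x + (t + s) *: a) - (t + s) * q a <= q (x + t *: a) - t * q a.
Proof.
move=> t0 s0; have := qP.1.1 (x + t *: a) (s *: a).
rewrite -addrA -scalerDl (qP.1.2 s a s0); lra.
Qed.

Lemma shiftfun_le x : shiftfun x <= q x.
Proof. by have := shift_le x (lexx 0); rewrite scale0r addr0 mul0r subr0. Qed.

Lemma shiftfunN : shiftfun (- a) <= - q a.
Proof.
have := shift_le (- a) (@ler01 R).
by rewrite scale1r addNr sublinear0 ?mul1r ?sub0r//; exact: qP.1.
Qed.

Lemma shiftfun_subfun : subfun shiftfun.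
Proof.
split; [split|].
- move=> x y; apply/ler_addgt0Pr => e e0.
  have e2 : 0 < e / 2 by rewrite divr_gt0.
  have [t t0 xt] := shift_near x e2; have [s s0 ys] := shift_near y e2.
  have := shift_le (x + y) (addr_ge0 t0 s0).
  have := qP.1.1 (x + t *: a) (y + s *: a).
  rewrite addrACA -scalerDl; lra.
(* One inequality for all [c > 0] suffices: applied to [c^-1] and [c *: x] it gives the converse. *)
- have h (c : R) x : 0 < c -> shiftfun (c *: x) <= c * shiftfun x.
    move=> c0; apply/ler_addgt0Pr => e e0.
    have [t t0 xt] := shift_near x (divr_gt0 e0 c0).
    have := shift_le (c *: x) (mulr_ge0 (ltW c0) t0).
    rewrite -scalerA -scalerDr (qP.1.2 c _ (ltW c0)) -mulrA -mulrBr.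
    move=> /le_trans; apply.
    by rewrite -ler_pdivlMl// mulrDr mulrA mulVf ?gt_eqF// mul1r [c^-1 * e]mulrC ltW.
  move=> c x; rewrite le_eqVlt => /predU1P[<-|c0].
    rewrite scale0r mul0r; apply/le_anti/andP; split.
      by have := shiftfun_le 0; rewrite (sublinear0 qP.1).
    apply: lb_le_inf; first by case: (E_inf 0).
    by move=> _ [t t0 <-]; rewrite add0r qP.1.2// subrr.
  apply/le_anti/andP; split; first exact: h.
  have := h c^-1 (c *: x); rewrite invr_gt0 => /(_ c0).
  by rewrite scalerA mulVf ?gt_eqF// scale1r -ler_pdivlMl ?invr_gt0// invrK.
- move=> x y z Pxyz; apply/ler_addgt0Pr => e e0.
  have [t t0 xt] := shift_near x e0; have [s s0 ys] := shift_near y e0.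
  have := shift_le z (addr_ge0 t0 s0).
  have xts := shift_anti x t0 s0; have := shift_anti y s0 t0.
  rewrite [s + t]addrC => yts.
  have := qP.2 _ _ _ (P_shift ((t + s) *: a) Pxyz).
  rewrite !le_max => /orP[] h1 h2.
    by rewrite -lerBlDr le_max; apply/orP; left; lra.
  by rewrite -lerBlDr le_max; apply/orP; right; lra.
Qed.

End Shift.

(** Zorn's lemma for the reversed pointwise order. The lower bound of a nonempty chain is its
    pointwise infimum, finite because each [q] below [p] satisfies [q x >= - p (- x)]. *)
Lemma subfun_minimal p : subfun p -> exists q,
  [/\ subfun q, forall x, q x <= p x &
      forall q', subfun q' -> (forall x, q' x <= q x) -> q' =1 q].
Proof.
move=> pP.
pose S := {q : V -> R | subfun q /\ forall x, q x <= p x}.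
pose ge (q q' : S) : bool := `[< forall x, sval q' x <= sval q x >].
have [] := @Zorn S ge.
- by move=> q; apply/asboolP.
- move=> q1 q2 q3 /asboolP h1 /asboolP h2; apply/asboolP => x.
  exact: le_trans (h1 x).
- move=> [q1 P1] [q2 P2] /asboolP h1 /asboolP h2; apply: eq_exist => /=.
  by apply/funext => x; apply/le_anti; rewrite h1 h2.
- move=> A totA.
  have [->|/set0P[q0 Aq0]] := eqVneq A set0.
    by exists (exist _ p (conj pP (fun x => lexx _))).
  pose E x := [set sval q x | q in A].
  have Elb x : has_lbound (E x).
    exists (- p (- x)) => _ [[q [qP qp]] _ <-] /=.
    by apply: le_trans (sublinearN x qP.1); rewrite lerN2.
  have Einf x : has_inf (E x) by split => //; exists (sval q0 x), q0.
  have inf_leq x (q : S) : A q -> inf (E x) <= sval q x.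
    by move=> Aq; apply: ge_inf => //; exists q.
  (* Totality of the chain lets a single member be nearly minimal at two points at once, so
     inequalities involving two values pass to the infimum. *)
  have near2 x y (e : R) : 0 < e -> exists2 q, A q &
      sval q x < inf (E x) + e /\ sval q y < inf (E y) + e.
    move=> e0; have [_ [q1 A1 <-] h1] := inf_adherent e0 (Einf x).
    have [_ [q2 A2 <-] h2] := inf_adherent e0 (Einf y).
    have [/asboolP h|/asboolP h] := totA _ _ A1 A2.
      by exists q2 => //; split => //; apply: le_lt_trans h1.
    by exists q1 => //; split => //; apply: le_lt_trans h2.
  have infP : subfun (fun x => inf (E x)).
    split; [split|].
    + move=> x y; apply/ler_addgt0Pr => e e0.
      have [q Aq [qx qy]] := near2 x y _ (divr_gt0 e0 (ltr0Sn R 1)).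
      have := inf_leq (x + y) _ Aq; have := (svalP q).1.1.1 x y; lra.
    + have h (c : R) x : 0 <= c -> inf (E (c *: x)) <= c * inf (E x).
        move=> c0; apply/ler_addgt0Pr => e e0.
        have c1 : 0 < c + 1 by rewrite ltr_wpDl.
        have [q Aq [qx _]] := near2 x x _ (divr_gt0 e0 c1).
        have := inf_leq (c *: x) _ Aq; rewrite ((svalP q).1.1.2 c x c0).
        move=> /le_trans; apply.
        apply: (@le_trans _ _ (c * (inf (E x) + e / (c + 1)))).
          by rewrite ler_wpM2l// ltW.
        rewrite mulrDr lerD2l mulrCA -[X in _ <= X]mulr1 ler_wpM2l ?ltW//.
        by rewrite ltr_pdivrMr// mul1r ltrDl.
      move=> c x; rewrite le_eqVlt => /predU1P[<-|c0].
        rewrite scale0r mul0r; apply/le_anti/andP; split.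
          by have := inf_leq 0 _ Aq0; rewrite (sublinear0 (svalP q0).1.1).
        apply: lb_le_inf; first by case: (Einf 0).
        by move=> _ [q _ <-]; rewrite (sublinear0 (svalP q).1.1).
      apply/le_anti/andP; split; first exact/h/ltW.
      have := h c^-1 (c *: x); rewrite invr_ge0 => /(_ (ltW c0)).
      by rewrite scalerA mulVf ?gt_eqF// scale1r -ler_pdivlMl ?invr_gt0// invrK.
    + move=> x y z Pxyz; apply/ler_addgt0Pr => e e0.
      have [q Aq [qx qy]] := near2 x y _ e0.
      have := inf_leq z _ Aq; have := (svalP q).1.2 _ _ _ Pxyz.
      by rewrite -lerBlDr !le_max => /orP[] h1 h2; apply/orP;
        [left|right]; lra.
  have infp x : inf (E x) <= p x.
    by apply: le_trans (inf_leq x _ Aq0) _; exact: (svalP q0).2.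
  exists (exist _ (fun x => inf (E x)) (conj infP infp) : S) => q Aq; apply/asboolP => x.
  exact: inf_leq.
- move=> [q [qP qp]] qmin; exists q; split => // q' q'P q'q.
  have q'p x : q' x <= p x by apply: le_trans (qp x).
  have ge' : ge (exist _ q (conj qP qp) : S) (exist _ q' (conj q'P q'p) : S).
    exact/asboolP.
  by move=> x; have := congr1 (fun r : S => sval r x) (qmin _ ge').
Qed.

(* A minimal [q] agrees with its own shifts, hence [q (- a) <= - q a]. *)
Lemma subfun_dominated p : subfun p -> exists l : V -> R,
  [/\ forall x y, l (x + y) = l x + l y, forall c x, l (c *: x) = c * l x,
      forall x, l x <= p x & submax l].
Proof.
move=> /subfun_minimal[q [qP qp qmin]].
have qN x : q (- x) = - q x.
  have := qmin _ (shiftfun_subfun x qP) (shiftfun_le x qP) (- x).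
  have := shiftfunN x qP; have := sublinearN x qP.1; lra.
have qZ (c : R) x : q (c *: x) = c * q x.
  have [c0|c0] := leP 0 c; first exact: qP.1.2.
  rewrite -[c *: x]opprK -scaleNr qN qP.1.2; first by rewrite mulNr opprK.
  by rewrite oppr_ge0 ltW.
exists q; split => //; last exact: qP.2.
move=> x y; apply/le_anti; rewrite qP.1.1/=.
have := qP.1.1 (- x) (- y); rewrite -opprD !qN; lra.
Qed.

End Sublinear.

Section Points.
Variables (R : realType) (V : vectorLatticeType R).
Implicit Types (x y z : V) (f : V -> R).

Definition lattice_functional f :=
  [/\ forall x y, f (x + y) = f x + f y, forall (c : R) x, f (c *: x) = c * f x &
      forall x y, f (vjoin x y) = Num.max (f x) (f y)].

Section LatticeFunctionalTheory.
Variable f : V -> R.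
Hypothesis fP : lattice_functional f.

Lemma latfD x y : f (x + y) = f x + f y. Proof. by case: fP. Qed.
Lemma latfZ (c : R) x : f (c *: x) = c * f x. Proof. by case: fP. Qed.
Lemma latfU x y : f (vjoin x y) = Num.max (f x) (f y). Proof. by case: fP. Qed.
Lemma latf0 : f 0 = 0.
Proof. by rewrite -(scale0r (0 : V)) latfZ mul0r. Qed.
Lemma latfN x : f (- x) = - f x.
Proof. by rewrite -scaleN1r latfZ mulN1r. Qed.
Lemma latfB x y : f (x - y) = f x - f y.
Proof. by rewrite latfD latfN. Qed.
Lemma latfI x y : f (vmeet x y) = Num.min (f x) (f y).
Proof. by rewrite vmeetE latfN latfU !latfN oppr_max !opprK. Qed.
Lemma latf_modulus x : f (modulus x) = `|f x|.
Proof.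
by rewrite latfU latfN maxEle; case: (ler0P (f x)) => ?; case: ifPn => ?; lra.
Qed.
Lemma latf_le x y : vle x y -> f x <= f y.
Proof.
move=> xy; have -> : y = vjoin x y.
  by apply: vle_anti; rewrite vle_joinr vleUx xy vle_refl.
by rewrite latfU le_max lexx.
Qed.
Lemma latf_ge0 x : vle 0 x -> 0 <= f x.
Proof. by move=> /latf_le; rewrite latf0. Qed.

Definition latfE :=
  (latf_modulus, latfD, latfB, latfN, latfZ, latfU, latfI, latf0).

End LatticeFunctionalTheory.

Variable u : V.

Definition order_unit := vle 0 u /\ forall x, exists c : R, vle x (c *: u).

Definition archimedean_unit :=
  forall x, (forall e : R, 0 < e -> vle x (e *: u)) -> vle x 0.

Hypotheses (uP : order_unit) (uA : archimedean_unit).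

Let scale_le (c d : R) : c <= d -> vle (c *: u) (d *: u).
Proof.
move=> cd; rewrite -vsubr_ge0 -scalerBl vscaler_ge0 ?subr_ge0//.
exact: uP.1.
Qed.

(* The gauge [p] preserves joins, and this survives the minimization. *)
Lemma lattice_functional_pos x : ~~ vle x 0 ->
  exists f, [/\ lattice_functional f, f u = 1 & 0 < f x].
Proof.
move=> x0.
have u0 : ~~ vle u 0.
  apply: contra x0 => u0; have u00 : u = 0 by apply: vle_anti; rewrite u0 uP.1.
  by have [c] := uP.2 x; rewrite u00 scaler0.
(* This bounds the sets [E y] from below, so that the gauge [p] is finite. *)
have neg_unit (c : R) : vle 0 (c *: u) -> 0 <= c.
  move=> cu; rewrite leNgt; apply/negP => c0; move/negP: u0; apply.
  have := vscaler_ge0 (_ : 0 <= - c^-1) cu.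
  rewrite scalerA mulNr mulVf ?lt_eqF// scaleN1r oppr_ge0 invr_le0 => /(_ (ltW c0)).
  by rewrite -vleN2 opprK oppr0.
pose E y := [set c : R | vle y (c *: u)].
pose p y := inf (E y).
have E_inf y : has_inf (E y).
  split; first exact: uP.2.
  have [C yC] := uP.2 (- y); exists (- C) => c /= yc.
  rewrite -subr_ge0 opprK; apply: neg_unit.
  by rewrite scalerDl -(subrr y) vleD.
have p_le y c : vle y (c *: u) -> p y <= c.
  by move=> yc; apply: ge_inf => //; case: (E_inf y).
have p_lt y c : p y < c -> vle y (c *: u).
  rewrite -subr_gt0 => pc; have [d /= yd] := inf_adherent pc (E_inf y).
  rewrite addrC subrK => dc.
  exact: vle_trans yd (scale_le (ltW dc)).
have pZ (c : R) y : 0 < c -> p (c *: y) <= c * p y.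
  move=> c0; apply/ler_addgt0Pr => e e0; apply: p_le.
  have -> : c * p y + e = c * (p y + e / c) by field; rewrite gt_eqF.
  by rewrite -scalerA vleZ2l ?ltW// p_lt// ltrDl divr_gt0.
have pP : subfun (fun y z t => t = vjoin y z) p.
  split; [split|].
  - move=> y z; apply/ler_addgt0Pr => e e0; apply: p_le.
    have -> : p y + p z + e = (p y + e / 2) + (p z + e / 2) by lra.
    by rewrite scalerDl vleD// p_lt// ltrDl divr_gt0.
  - move=> c y; rewrite le_eqVlt => /predU1P[<-|c0].
      rewrite scale0r mul0r; apply/le_anti/andP; split.
        by apply: p_le; rewrite scale0r vle_refl.
      by apply: lb_le_inf; [case: (E_inf 0) | move=> d; exact: neg_unit].
    apply/le_anti; rewrite pZ//=.
    have := pZ c^-1 (c *: y); rewrite invr_gt0 => /(_ c0).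
    by rewrite scalerA mulVf ?gt_eqF// scale1r -ler_pdivlMl ?invr_gt0// invrK.
  - move=> y z _ ->; apply/ler_addgt0Pr => e e0; apply: p_le.
    by rewrite vleUx !p_lt//; apply: ltr_pwDr => //; rewrite le_max lexx ?orbT.
have shift y z t w : t = vjoin y z -> t + w = vjoin (y + w) (z + w).
  by move=> ->; exact: vjoinDr.
(* Minimizing below the shift of [p] along [x], rather than below [p], forces [l (- x) <= - p x],
   that is [p x <= l x]; and [p x > 0] by the Archimedean property. *)
have [l [lD lZ lp lU]] := subfun_dominated shift (shiftfun_subfun shift x pP).
have lep y : l y <= p y by exact: le_trans (lp y) (shiftfun_le x pP y).
have lN y : l (- y) = - l y by rewrite -scaleN1r lZ mulN1r.
have l_le y z : vle y z -> l y <= l z.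
  move=> yz; rewrite -subr_le0 -lN -lD; apply: le_trans (lep _) _.
  by apply: p_le; rewrite scale0r -vleN2 oppr0 opprB vsubr_ge0.
exists l; split.
- split => // y z; apply/le_anti; rewrite lU//= ge_max.
  by rewrite !l_le ?vle_joinl ?vle_joinr.
- apply/le_anti; rewrite (le_trans (lep _))/=; last first.
    by apply: p_le; rewrite scale1r vle_refl.
  rewrite -lerN2 -lN (le_trans (lep _))//.
  by apply: p_le; rewrite scaleN1r vle_refl.
- apply: (@lt_le_trans _ _ (p x)).
    rewrite ltNge; apply: contra x0 => px0; apply: uA => e e0.
    by apply: p_lt; exact: le_lt_trans e0.
  by rewrite -lerN2 -lN; apply: le_trans (lp _) (shiftfunN x pP).
Qed.

(** If the inequality failed, a homomorphism positive at [x - y] would contradict the hypothesis.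
    Identities in [V] thereby reduce to identities of real numbers. *)
Lemma vle_pointwise x y :
  (forall f, lattice_functional f -> f u = 1 -> f x <= f y) -> vle x y.
Proof.
move=> h; apply: contrapT => /negP; rewrite -vsubr_ge0 -vleN2 oppr0 opprB.
move=> /lattice_functional_pos[f [fP fu]].
by rewrite (latfB fP) ltNge subr_le0 h.
Qed.

Lemma veq_pointwise x y :
  (forall f, lattice_functional f -> f u = 1 -> f x = f y) -> x = y.
Proof.
by move=> h; apply: vle_anti; apply/andP; split; apply: vle_pointwise => f fP fu;
  rewrite h.
Qed.

End Points.

(** * Principal ideals of a Banach lattice *)

Lemma geometric_lt (R : realType) (C r : R) : 0 < r -> exists n, C * 2^-1 ^+ n < r.
Proof.
move=> r0; have /(cvgrPdist_lt (FF := _))/(_ _ r0) :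
    (fun n => C * 2^-1 ^+ n) @ \oo --> (0 : R).
  rewrite -[0](mulr0 C); apply: cvgMr; apply: cvg_expr.
  by rewrite ger0_norm ?invr_ge0// invf_lt1// ltr1n.
case=> N _ /(_ N (leqnn _)); rewrite sub0r normrN => h; exists N.
exact: le_lt_trans (ler_norm _) h.
Qed.

Section BanachLatticeTheory.
Variables (R : realType) (X : banachLatticeType R).
Implicit Types x y z e : X.

Lemma norm_le_modulus x y : vle (modulus x) y -> `|x| <= `|y|.
Proof.
move=> xy; apply: le_norm_modulus; rewrite (modulus_id (x := y))//.
exact: vle_trans (modulus_ge0 x) xy.
Qed.

Lemma norm_modulus x : `|modulus x| = `|x|.
Proof.
apply/le_anti/andP; split; last exact/norm_le_modulus/vle_refl.
by apply: le_norm_modulus; rewrite modulus_id ?vle_refl ?modulus_ge0.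
Qed.

(** The order is closed: the positive part of [x - y] lies below the modulus of [z - y], so its norm
    is arbitrarily small. *)
Lemma vle_lim x y :
  (forall e : R, 0 < e -> exists2 z, vle x z & `|z - y| < e) -> vle x y.
Proof.
move=> h; rewrite -vsubr_ge0 -vleN2 oppr0 opprB.
suff /normr0_eq0 w0 : `|vjoin (x - y) 0| = 0 by rewrite -w0 vle_joinl.
apply/eqP; rewrite eq_le normr_ge0 andbT.
apply/ler_addgt0Pr => e /h[z xz zy]; rewrite add0r.
apply: le_trans (ltW zy); apply: le_norm_modulus.
rewrite (modulus_id (vle_joinr _ _)) vleUx modulus_ge0 andbT.
by apply: vle_trans (vle_modulus _); rewrite vle_add2r.
Qed.

Lemma geometric_cvg (x_ : nat -> X) (C : R) :
  (forall n, `|x_ n.+1 - x_ n| <= C * 2^-1 ^+ n) ->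
  exists l, forall e : R, 0 < e -> exists N, forall n, (N <= n)%N -> `|x_ n - l| < e.
Proof.
move=> xC.
have C0 : 0 <= C by have := le_trans (normr_ge0 _) (xC 0%N); rewrite mulr1.
have xm m n : `|x_ (n + m)%N - x_ n| <= 2 * C * (2^-1 ^+ n - 2^-1 ^+ (n + m)).
  elim: m => [|m ih]; first by rewrite addn0 !subrr normr0 mulr0.
  rewrite addnS (_ : _ - _ = (x_ (n + m).+1 - x_ (n + m)%N) + (x_ (n + m)%N - x_ n)).
    apply: le_trans (ler_normD _ _) _; have := xC (n + m)%N; rewrite exprS; lra.
  by rewrite addrA subrK.
have xN N n : (N <= n)%N -> `|x_ n - x_ N| <= 2 * C * 2^-1 ^+ N.
  move=> /subnKC <-; apply: le_trans (xm _ _) _.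
  by rewrite ler_wpM2l ?mulr_ge0// gerBl exprn_ge0 ?invr_ge0.
have : cvg (x_ @ \oo).
  apply: cauchy_cvg; apply/cauchy_exP => e e0.
  have [N eN] := geometric_lt (2 * C) e0.
  exists (x_ N); exists N => // n /= /xN nN.
  by rewrite -ball_normE /= distrC; exact: le_lt_trans eN.
move=> /cvg_ex[l /cvgrPdist_lt xl]; exists l => e /xl[N _ h].
by exists N => n Nn; rewrite distrC; exact: h.
Qed.

(** [e] is the sum of the terms [a n *: z n], whose weights [a n] make the series converge
    geometrically; by positivity each term lies below the sum. *)
Lemma dominating_element (z : nat -> X) : (forall n, vle 0 (z n)) ->
  exists2 e, vle 0 e & forall n, exists c : R, vle (z n) (c *: e).
Proof.
move=> z0; pose a n : R := 2^-1 ^+ n / (1 + `|z n|).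
have z1 n : 0 < 1 + `|z n| by rewrite ltr_pwDl.
have a0 n : 0 < a n by rewrite divr_gt0 ?exprn_gt0 ?invr_gt0.
pose s n := \sum_(i < n) a i *: z i.
have sS n : s n.+1 - s n = a n *: z n by rewrite /s big_ord_recr/= addrAC subrr add0r.
have s0 n : vle 0 (s n).
  elim: n => [|n ih]; first by rewrite /s big_ord0 vle_refl.
  by rewrite -[s n.+1](subrK (s n)) sS -[0]addr0 vleD ?vscaler_ge0// ltW.
have s_mono m n : vle (s n) (s (n + m)%N).
  elim: m => [|m ih]; first by rewrite addn0 vle_refl.
  by rewrite addnS; apply: vle_trans ih _; rewrite -vsubr_ge0 sS vscaler_ge0// ltW.
have [|e se] := @geometric_cvg s 1.
  move=> n; rewrite sS normrZ gtr0_norm// mul1r /a -mulrA ler_piMr ?exprn_ge0 ?invr_ge0//.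
  by rewrite mulrC ler_pdivrMr// mul1r lerDr.
have se_le n : vle (s n) e.
  apply: vle_lim => d /se[N /(_ (n + N)%N)]; rewrite leq_addl => /(_ isT) h.
  by exists (s (n + N)%N).
exists e => [|n]; first by have := se_le 0%N; rewrite /s big_ord0.
exists (a n)^-1; rewrite -[z n](scalerK (lt0r_neq0 (a0 n))).
rewrite vleZ2l ?invr_ge0 ?ltW//; apply: vle_trans (se_le n.+1).
by rewrite -sS -vsubr_ge0 opprB addrC subrK.
Qed.

End BanachLatticeTheory.

Section Ideal.
Variables (R : realType) (X : vectorLatticeType R).
Implicit Types x y : X.

Definition ideal_pred (e : X) : {pred X} :=
  fun x => `[< exists c : R, vle (modulus x) (c *: e) >].

Variable e : X.

Lemma ideal_submod : submod_closed (ideal_pred e).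
Proof.
split=> [|a x y].
  by apply/asboolP; exists 0; rewrite scale0r modulus_id vle_refl.
move=> /asboolP[c xc] /asboolP[d yd]; apply/asboolP; exists (`|a| * c + d).
apply: vle_trans (modulusD _ _) _; rewrite scalerDl vleD//.
by apply: vle_trans (modulusZ_le _ _) _; rewrite -scalerA vleZ2l.
Qed.

HB.instance Definition _ := GRing.isSubmodClosed.Build R X (ideal_pred e)
  ideal_submod.

Lemma ideal_join x y :
  x \in ideal_pred e -> y \in ideal_pred e -> vjoin x y \in ideal_pred e.
Proof.
move=> /asboolP[c xc] /asboolP[d yd]; apply/asboolP; exists (c + d).
apply: (@vle_trans _ _ (modulus x + modulus y)); last by rewrite scalerDl vleD.
rewrite modulus_le vleUx -!andbA; apply/and3P; split.
- by rewrite -[X in vle X _]addr0 vleD ?vle_modulus ?modulus_ge0.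
- by rewrite -[X in vle X _]add0r vleD ?vle_modulus ?modulus_ge0.
- rewrite -[X in vle X _]addr0 vleD ?modulus_ge0//.
  by apply: vle_trans (vleN_modulus x); rewrite vleN2 vle_joinl.
Qed.

Lemma ideal_meet x y :
  x \in ideal_pred e -> y \in ideal_pred e -> vmeet x y \in ideal_pred e.
Proof. by move=> xe ye; rewrite vmeetE rpredN ideal_join ?rpredN. Qed.

End Ideal.

Definition ideal (R : realType) (X : vectorLatticeType R) (e : X) : Type :=
  {x : X | x \in ideal_pred e}.

Section IdealLattice.
Variables (R : realType) (X : vectorLatticeType R) (e : X).
Local Notation V := (ideal e).

HB.instance Definition _ := SubChoice.copy V {x : X | x \in ideal_pred e}.
HB.instance Definition _ := [SubChoice_isSubLmodule of V by <:].

Implicit Types x y z : V.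

Definition ideal_le : rel V := fun x y => vle (val x) (val y).
Definition ideal_vjoin x y : V :=
  exist _ (vjoin (val x) (val y)) (ideal_join (valP x) (valP y)).
Definition ideal_vmeet x y : V :=
  exist _ (vmeet (val x) (val y)) (ideal_meet (valP x) (valP y)).

Lemma ideal_le_refl : reflexive ideal_le.
Proof. by move=> x; exact: vle_refl. Qed.
Lemma ideal_le_anti : antisymmetric ideal_le.
Proof. by move=> x y /vle_anti/val_inj. Qed.
Lemma ideal_le_trans : transitive ideal_le.
Proof. by move=> y x z; exact: vle_trans. Qed.
Lemma ideal_lexI x y z : ideal_le x (ideal_vmeet y z) = ideal_le x y && ideal_le x z.
Proof. by rewrite /ideal_le /= vlexI. Qed.
Lemma ideal_leUx x y z : ideal_le (ideal_vjoin x y) z = ideal_le x z && ideal_le y z.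
Proof. by rewrite /ideal_le /= vleUx. Qed.
Lemma ideal_leD2r z x y : ideal_le x y -> ideal_le (x + z) (y + z).
Proof. exact: vleD2r. Qed.
Lemma ideal_leZ2l (a : R) x y : 0 <= a -> ideal_le x y -> ideal_le (a *: x) (a *: y).
Proof. exact: vleZ2l. Qed.

HB.instance Definition _ := Lmodule_isVectorLattice.Build R V
  ideal_le_refl ideal_le_anti ideal_le_trans ideal_lexI ideal_leUx
  ideal_leD2r ideal_leZ2l.

Lemma val_vle x y : vle (val x) (val y) = vle x y. Proof. by []. Qed.
Lemma val_vjoin x y : val (vjoin x y) = vjoin (val x) (val y). Proof. by []. Qed.
Lemma val_vmeet x y : val (vmeet x y) = vmeet (val x) (val y). Proof. by []. Qed.
Lemma val_modulus x : val (modulus x) = modulus (val x). Proof. by []. Qed.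
Lemma val_idealD x y : val (x + y) = val x + val y. Proof. by []. Qed.
Lemma val_idealZ (a : R) x : val (a *: x) = a *: val x. Proof. by []. Qed.

End IdealLattice.

Section OrderUnitScale.
Variables (R : realType) (V : vectorLatticeType R) (u : V) (k : R).
Hypothesis k0 : 0 < k.

Lemma order_unitZ : order_unit u -> order_unit (k *: u).
Proof.
move=> [u0 uV]; split; first by rewrite vscaler_ge0// ltW.
move=> x; have [c xc] := uV x; exists (c / k).
by rewrite scalerA divfK// gt_eqF.
Qed.

Lemma archimedean_unitZ : archimedean_unit u -> archimedean_unit (k *: u).
Proof.
move=> uA x xu; apply: uA => c c0.
by have := xu _ (divr_gt0 c0 k0); rewrite scalerA divfK// gt_eqF.
Qed.

End OrderUnitScale.

Section BanachIdeal.
Variables (R : realType) (X : banachLatticeType R) (e : X).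
Hypothesis e0 : vle 0 e.
Local Notation V := (ideal e).
Implicit Types v w : V.

Lemma ideal_unit_subproof : e \in ideal_pred e.
Proof. by apply/asboolP; exists 1; rewrite scale1r modulus_id// vle_refl. Qed.

Definition ideal_unit : V := exist _ e ideal_unit_subproof.

Lemma ideal_order_unit : order_unit ideal_unit.
Proof.
split=> [|x]; first exact: e0.
have /asboolP[c xc] := valP x; exists c.
exact: vle_trans (vle_modulus _) xc.
Qed.

Lemma ideal_archimedean : archimedean_unit ideal_unit.
Proof.
move=> x xe; rewrite -val_vle; apply: vle_lim => d d0.
have c0 : 0 < 1 + `|e| by rewrite ltr_pwDl.
exists (val ((d / (1 + `|e|)) *: ideal_unit)); first by apply: xe; rewrite divr_gt0.
rewrite subr0 val_idealZ normrZ gtr0_norm ?divr_gt0// mulrAC ltr_pdivrMr//.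
by rewrite ltr_pM2l// ltrDr.
Qed.

(** Uniform completeness of the principal ideal. The sequence converges in the norm of [X]; since
    the order is closed, the order estimates survive in the limit and place it in the ideal. *)
Lemma ideal_cvg (v_ : nat -> V) (C : R) : 0 <= C ->
  (forall n, vle (modulus (v_ n.+1 - v_ n)) ((C * 2^-1 ^+ n) *: ideal_unit)) ->
  exists w, forall n,
    vle (modulus (w - v_ n)) ((2 * C * 2^-1 ^+ n) *: ideal_unit).
Proof.
move=> C0 vC.
have vm m n : vle (modulus (v_ (n + m)%N - v_ n))
    ((2 * C * (2^-1 ^+ n - 2^-1 ^+ (n + m))) *: ideal_unit).
  elim: m => [|m ih]; first by rewrite addn0 !subrr mulr0 scale0r modulus_id vle_refl.
  rewrite addnS (_ : _ - _ = (v_ (n + m).+1 - v_ (n + m)%N) + (v_ (n + m)%N - v_ n)).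
    apply: vle_trans (modulusD _ _) _.
    rewrite (_ : _ * _ = C * 2^-1 ^+ (n + m)%N +
      2 * C * (2^-1 ^+ n - 2^-1 ^+ (n + m))); last by rewrite exprS; lra.
    by rewrite scalerDl vleD.
  by rewrite addrA subrK.
have [|l vl] := @geometric_cvg _ _ (val \o v_) (C * `|e|).
  move=> n /=; apply: le_trans (norm_le_modulus (vC n)) _.
  rewrite val_idealZ normrZ ger0_norm ?mulr_ge0 ?exprn_ge0 ?invr_ge0//.
  by rewrite mulrAC.
pose K n : X := (2 * C * 2^-1 ^+ n) *: e.
have vK m n : (n <= m)%N -> vle (modulus (val (v_ m) - val (v_ n))) (K n).
  move=> /subnKC <-; have := vm (m - n)%N n; rewrite -val_vle => h.
  apply: vle_trans h _; rewrite val_idealZ /K -vsubr_ge0 -scalerBl vscaler_ge0// -mulrBr.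
  by rewrite mulr_ge0 ?mulr_ge0// opprB addrC subrK exprn_ge0 ?invr_ge0.
have lK n : vle (modulus (l - val (v_ n))) (K n).
  rewrite modulus_le -[X in X && _]vleN2 -[X in _ && X]vleN2 opprK.
  apply/andP; split; apply: vle_lim => d /vl[N /(_ _ (leq_maxl N n))/= h].
    exists (val (v_ n) - val (v_ (maxn N n))).
      by rewrite -vleN2 !opprK opprB; apply: vle_trans (vle_modulus _) (vK _ _ (leq_maxr _ _)).
    by rewrite opprK addrC addrA subrK distrC.
  exists (val (v_ (maxn N n)) - val (v_ n)).
    rewrite -vleN2 opprK; apply: vle_trans (vleN_modulus _) (vK _ _ (leq_maxr _ _)).
  by rewrite opprB addrA subrK.
have lV : l \in ideal_pred e.
  have /asboolP[c vc] := valP (v_ 0%N); apply/asboolP; exists (2 * C + c).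
  rewrite -(subrK (val (v_ 0%N)) l); apply: vle_trans (modulusD _ _) _.
  by rewrite scalerDl vleD//; have := lK 0%N; rewrite /K expr0 mulr1.
by exists (exist _ l lV).
Qed.

(* Stated for [k *: ideal_unit], so that the unit may be rescaled without
   changing the ideal. *)
Lemma pointwise_complete (k : R) (u : V) (F : (V -> R) -> R) :
  0 < k -> u = k *: ideal_unit ->
  (forall d : R, 0 < d -> exists v, forall f,
     lattice_functional f -> f u = 1 -> `|f v - F f| <= d) ->
  exists v, forall f, lattice_functional f -> f u = 1 -> f v = F f.
Proof.
move=> k0 uE Fap.
have half (n : nat) : 0 < 2^-1 ^+ n :> R by rewrite exprn_gt0// invr_gt0.
have /choice[v_ vF] := fun n => Fap _ (half n).
have uP : order_unit u
    by rewrite uE; exact: order_unitZ ideal_order_unit.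
have uA : archimedean_unit u by rewrite uE; exact: archimedean_unitZ ideal_archimedean.
(* Consecutive approximants differ by at most [2^-1 ^+ n + 2^-1 ^+ n.+1], which is below
   [2 * 2^-1 ^+ n]; the factor [k] converts from [u] to [ideal_unit]. *)
have [||w wv] := @ideal_cvg v_ (2 * k); first by rewrite mulr_ge0// ltW.
  move=> n; rewrite mulrAC -scalerA -uE; apply: (vle_pointwise uP uA) => f fP fu.
  rewrite !(latfE fP) fu mulr1.
  have := vF n f fP fu; have := vF n.+1 f fP fu; rewrite exprS.
  rewrite !ler_norml => /andP[? ?] /andP[? ?].
  by apply/andP; split; have := half n; lra.
exists w => f fP fu; apply/eqP; rewrite -subr_eq0 -normr_le0.
apply/ler_addgt0Pr => d d0; rewrite add0r.
(* Four parts of [2^-1 ^+ n] separate [w] from [v_ n], and one part separates [v_ n] from [F]. *)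
have [n nd] := geometric_lt 5 d0.
have := latf_le fP (wv n); rewrite mulrA mulrAC -scalerA -uE.
rewrite !(latfE fP) fu mulr1; have := vF n f fP fu.
rewrite !ler_norml => /andP[? ?] /andP[? ?].
by apply/andP; split; lra.
Qed.

End BanachIdeal.

(** * Averages over signs *)

Section SignAverage.
Variable R : realType.

(** The average of the modulus of [x + sum_i (+- a_i)] over all choices of signs, the lattice-valued
    first moment of a Rademacher sum. *)
Fixpoint sgnavg (V : vectorLatticeType R) (l : seq V) (x : V) : V :=
  if l is a :: l' then 2^-1 *: (sgnavg l' (x + a) + sgnavg l' (x - a))
  else modulus x.

Fixpoint rsgnavg (l : seq R) (x : R) : R :=
  if l is a :: l' then 2^-1 * (rsgnavg l' (x + a) + rsgnavg l' (x - a))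
  else `|x|.

Lemma latf_sgnavg (V : vectorLatticeType R) (f : V -> R) l x :
  lattice_functional f -> f (sgnavg l x) = rsgnavg (map f l) (f x).
Proof.
move=> fP; elim: l x => [|a l ih] x /=; first by rewrite (latfE fP).
by rewrite !(latfE fP) !ih !(latfE fP).
Qed.

Let sqsum (l : seq R) := \sum_(a <- l) a ^+ 2.

(* [|x| >= (3 c x^2 - c^3 x^4) / 2], averaged over all signs: the second moment
   of [x + sum_i (+- a_i)] is [x^2 + B], its fourth moment at most
   [x^4 + 6 x^2 B + 3 B^2]. *)
Lemma rsgnavg_moments l x (c : R) : 0 < c ->
  2^-1 * (3 * c * (x ^+ 2 + sqsum l) -
    c ^+ 3 * (x ^+ 4 + 6 * x ^+ 2 * sqsum l + 3 * sqsum l ^+ 2)) <= rsgnavg l x.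
Proof.
move=> c0; elim: l x => [|a l ih] x /=.
  rewrite /sqsum big_nil; set t := `|x|.
  have -> : x ^+ 2 = t ^+ 2 by rewrite real_normK// num_real.
  have -> : x ^+ 4 = t ^+ 4.
    by rewrite -[4%N]/(2 * 2)%N !exprM real_normK// num_real.
  have t0 : 0 <= t by exact: normr_ge0.
  (* Twice the gap [t - (3 c t^2 - c^3 t^4) / 2] factors in this way, with a double root at
     [c * t = 1]. *)
  have h : 0 <= t * (c * t - 1) ^+ 2 * (c * t + 2).
    apply: mulr_ge0; first by apply: mulr_ge0 => //; exact: sqr_ge0.
    by rewrite addr_ge0// mulr_ge0// ltW.
  suff : 2^-1 * (3 * c * t ^+ 2 - c ^+ 3 * t ^+ 4) <= t by lra.
  have : t * (c * t - 1) ^+ 2 * (c * t + 2) =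
    c ^+ 3 * t ^+ 4 - 3 * c * t ^+ 2 + 2 * t by ring.
  lra.
have := ih (x + a); have := ih (x - a).
have -> : sqsum (a :: l) = a ^+ 2 + sqsum l by rewrite /sqsum big_cons.
move: (sqsum l) (rsgnavg _ _) (rsgnavg _ _) => B r s hr hs.
have h : 0 <= c ^+ 3 * a ^+ 4.
  apply: mulr_ge0; first by rewrite exprn_ge0// ltW.
  by rewrite -[4%N]/(2 * 2)%N exprM sqr_ge0.
(* Averaging the two bounds at [x + a] and [x - a] reproduces the bound for [a :: l] up to the
   nonnegative surplus [c ^+ 3 * a ^+ 4], since the fourth moment is only overestimated. *)
have : 2^-1 * (2^-1 * (3 * c * ((x + a) ^+ 2 + B) -
    c ^+ 3 * ((x + a) ^+ 4 + 6 * (x + a) ^+ 2 * B + 3 * B ^+ 2)) +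
  2^-1 * (3 * c * ((x - a) ^+ 2 + B) -
    c ^+ 3 * ((x - a) ^+ 4 + 6 * (x - a) ^+ 2 * B + 3 * B ^+ 2))) =
  2^-1 * (3 * c * (x ^+ 2 + (a ^+ 2 + B)) -
    c ^+ 3 * (x ^+ 4 + 6 * x ^+ 2 * (a ^+ 2 + B) + 3 * (a ^+ 2 + B) ^+ 2)) +
  c ^+ 3 * a ^+ 4 by field.
lra.
Qed.

(** AM-GM on each term. The free parameter [c] turns this into Cauchy-Schwarz once it is
    optimized. *)
Lemma sum_abs_sqsum l (c : R) : 0 < c ->
  \sum_(a <- l) `|a| <= 2^-1 * (c * sqsum l + (size l)%:R / c).
Proof.
move=> c0; rewrite /sqsum; elim: l => [|a l ih] /=.
  by rewrite !big_nil mulr0 mul0r addr0 mulr0.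
rewrite !big_cons -[(size l).+1%:R]natr1.
have : `|a| <= 2^-1 * (c * a ^+ 2 + c^-1).
  have -> : a ^+ 2 = `|a| ^+ 2 by rewrite real_normK// num_real.
  have : 0 <= c^-1 * (c * `|a| - 1) ^+ 2.
    by rewrite mulr_ge0 ?sqr_ge0// invr_ge0 ltW.
  have -> : c^-1 * (c * `|a| - 1) ^+ 2 = c * `|a| ^+ 2 + c^-1 - 2 * `|a|.
    by field; rewrite gt_eqF.
  lra.
rewrite [(_ + 1) / c]mulrDl mul1r.
move: ih; move: c^-1 (_ / c) => d nd; lra.
Qed.

Lemma rsgnavg_ge0 l x : 0 <= rsgnavg l x.
Proof.
elim: l x => [|a l ih] x /=; first exact: normr_ge0.
by rewrite mulr_ge0 ?invr_ge0// addr_ge0.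
Qed.

(** Cauchy-Schwarz bounds the sum by [n * r], where [r] is the Euclidean norm of [l] and [n] the
    root of its length; Khintchine's inequality, with constant [1 / 2], bounds [r] by twice the
    average. *)
Lemma sum_abs_sgnavg l :
  \sum_(a <- l) `|a| <= 2 * Num.sqrt (size l)%:R * rsgnavg l 0.
Proof.
have [l0|l0] := eqVneq (sqsum l) 0.
  have -> : \sum_(a <- l) `|a| = 0.
    elim: l l0 => [|a l ih]; first by rewrite big_nil.
    rewrite /sqsum !big_cons => /eqP; rewrite paddr_eq0 ?sqr_ge0//; last first.
      by apply: sumr_ge0 => b _; exact: sqr_ge0.
    by rewrite sqrf_eq0 => /andP[/eqP -> /eqP/ih ->]; rewrite normr0 addr0.
  by rewrite !mulr_ge0 ?sqrtr_ge0 ?rsgnavg_ge0.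
have B0 : 0 < sqsum l.
  by rewrite lt_neqAle eq_sym l0 sumr_ge0// => a _; exact: sqr_ge0.
pose r := Num.sqrt (sqsum l); pose n := Num.sqrt (size l)%:R : R.
have r0 : 0 < r by rewrite sqrtr_gt0.
have rB : sqsum l = r ^+ 2 by rewrite sqr_sqrtr// ltW.
have n0 : 0 < n.
  rewrite sqrtr_gt0 ltr0n; case: l l0 {B0 r r0 rB n} => //.
  by rewrite /sqsum big_nil eqxx.
have nE : (size l)%:R = n ^+ 2 by rewrite sqr_sqrtr.
(* With [c = g / r] the moment bound is [(3 g - 3 g^3) / 2 * r]. The rational [g = 2 / 3], close to
   the optimal [1 / sqrt 3], gives [5 / 9 * r], enough for [r / 2]. *)
have c0 : 0 < 2 / (3 * r) by rewrite divr_gt0// mulr_gt0.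
have h1 : 2^-1 * r <= rsgnavg l 0.
  have := rsgnavg_moments l 0 c0; rewrite rB !expr0n/= mulr0 mul0r !add0r.
  have -> : 2^-1 * (3 * (2 / (3 * r)) * r ^+ 2 -
      (2 / (3 * r)) ^+ 3 * (3 * (r ^+ 2) ^+ 2)) = 5 / 9 * r.
    by field; rewrite gt_eqF.
  lra.
have h2 : \sum_(a <- l) `|a| <= n * r.
  have := sum_abs_sqsum l (divr_gt0 n0 r0); rewrite rB nE.
  have -> // : 2^-1 * (n / r * r ^+ 2 + n ^+ 2 / (n / r)) = n * r.
  by field; rewrite !gt_eqF.
apply: le_trans h2 _; rewrite -/n.
have : n * (2^-1 * r) <= n * rsgnavg l 0 by rewrite ler_wpM2l// ltW.
lra.
Qed.

End SignAverage.

(** * Bump functions on the binary tree *)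

Section Bumps.
Variable R : realType.
Local Notation I := (unit_itv R).
Local Notation C := (C01 R).

Lemma C01_const_subproof (c : R) : continuous (fun _ : I => c).
Proof. by move=> t; exact: cst_continuous. Qed.
Definition C01_const (c : R) : C := C01_of (@C01_const_subproof c).

Lemma C01_id_subproof : continuous (fun t : I => val t : R).
Proof. exact: initial_continuous. Qed.
Definition C01_id : C := C01_of C01_id_subproof.

(* Binary words are stored with their last digit first: the children of the node
   [s] are [true :: s] and [false :: s]. *)
Fixpoint zoom (s : seq bool) : C :=
  if s is b :: s' then 8 *: zoom s' + C01_const (if b then - 4 else 4)
  else 4 *: C01_id - C01_const 2.

(** A trapezoid over the affine coordinate [zoom s]: plateau on [[-1, 1]], support in [[-2, 2]]. The
    factor 8 and the shifts by 4 put the supports of the children at [zoom s] in [[1/4, 3/4]] and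
    [[-3/4, -1/4]], disjoint and inside the plateau of the parent. *)
Definition bump (s : seq bool) : C :=
  vmeet (C01_const 1) (vjoin 0 (C01_const 2 - modulus (zoom s))).

Lemma modulus_C01E (f : C) (p : I) : modulus f p = `|f p|.
Proof.
have -> : modulus f p = Num.max (f p) (- f p) by [].
rewrite maxEle.
by case: (ler0P (f p)) => ?; case: ifPn => ?; lra.
Qed.

Lemma bumpE s p : bump s p = Num.min 1 (Num.max 0 (2 - `|zoom s p|)).
Proof. by rewrite -modulus_C01E. Qed.

Opaque bump.

Lemma zoom_cons b s p : zoom (b :: s) p = 8 * zoom s p + (if b then - 4 else 4).
Proof. by []. Qed.

Lemma bump_ge0 s p : 0 <= bump s p.
Proof. by rewrite bumpE le_min ler01 le_max lexx. Qed.

Lemma bump_le1 s p : bump s p <= 1.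
Proof. by rewrite bumpE ge_min lexx. Qed.

Lemma bump_eq0 s p : 2 <= `|zoom s p| -> bump s p = 0.
Proof.
move=> h; rewrite bumpE max_l; first by rewrite min_r.
by rewrite subr_le0.
Qed.

Lemma bump_eq1 s p : `|zoom s p| <= 1 -> bump s p = 1.
Proof. by move=> h; rewrite bumpE min_l// le_max; apply/orP; right; lra. Qed.

Lemma bump_cons b s p : bump (b :: s) p != 0 -> bump s p = 1.
Proof.
move=> h; apply: bump_eq1.
have : `|zoom (b :: s) p| < 2 by rewrite ltNge; apply: contra h => /bump_eq0 ->.
rewrite zoom_cons ltr_norml ler_norml => /andP[]; case: b {h} => h1 h2.
  by apply/andP; split; lra.
by apply/andP; split; lra.
Qed.

Lemma bump_cons_le b s p : bump (b :: s) p <= bump s p.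
Proof.
have [->|/bump_cons ->] := eqVneq (bump (b :: s) p) 0; first exact: bump_ge0.
exact: bump_le1.
Qed.

Lemma bump_disjoint s r p : size s = size r -> s != r ->
  bump s p != 0 -> bump r p = 0.
Proof.
elim: s r => [|b s ih] [|c r]// [] sr.
have [{sr}<- bcs h|nsr _ h] := eqVneq s r.
  have bc : b != c by apply: contraNneq bcs => ->.
  apply: bump_eq0.
  have : `|zoom (b :: s) p| < 2 by rewrite ltNge; apply: contra h => /bump_eq0 ->.
  rewrite !zoom_cons ltr_norml ler_normr => /andP[].
  by case: b c bc {bcs h ih} => [] [] //= _ h1 h2; apply/orP; [left|right]; lra.
(* The parents already differ: [bump s p] is 1, so [bump r p] vanishes by induction, and a child
   lies below its parent. *)
apply/eqP; rewrite eq_le bump_ge0 andbT.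
apply: le_trans (bump_cons_le _ _ _) _; rewrite (ih r)// (bump_cons h).
exact: oner_neq0.
Qed.

(** This provides the zero of [zoom s] used as [center s]. The range [[-2, 2]] is stable in the
    induction, as [(y - 4) / 8] and [(y + 4) / 8] stay within it. *)
Lemma zoom_onto s (y : R) : `|y| <= 2 -> exists p, zoom s p = y.
Proof.
rewrite ler_norml; elim: s y => [|b s ih] y /andP[y1 y2].
  have [p pE] : exists p : I, val p = (y + 2) / 4.
    have h : (y + 2) / 4 \in (`[0, 1]%classic : set R).
      by rewrite inE /= in_itv /=; apply/andP; split; lra.
    by exists (SigSub h).
  exists p; have -> : zoom [::] p = 4 * val p - 2 by [].
  by rewrite pE; lra.
have [|p pE] := ih ((y - (if b then - 4 else 4)) / 8).
  by apply/andP; split; case: b; lra.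
exists p; rewrite zoom_cons pE; lra.
Qed.

Fixpoint prefix_of (t : nat -> bool) (n : nat) : seq bool :=
  if n is m.+1 then t m :: prefix_of t m else [::].

Lemma size_prefix_of t n : size (prefix_of t n) = n.
Proof. by elim: n => //= n ->. Qed.

Lemma bump_prefix_le t n m p : (n <= m)%N ->
  bump (prefix_of t m) p <= bump (prefix_of t n) p.
Proof.
move=> /subnKC <-; elim: (m - n)%N => [|k ih]; first by rewrite addn0.
by rewrite addnS; apply: le_trans (bump_cons_le _ _ _) ih.
Qed.

Definition center (s : seq bool) : I := xget (unit_itv_nonempty R) [set p | zoom s p = 0].

Lemma bump_center t n m : (n <= m)%N -> bump (prefix_of t n) (center (prefix_of t m)) = 1.
Proof.
move=> nm; apply/le_anti; rewrite bump_le1/=; apply: le_trans (bump_prefix_le _ _ nm).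
rewrite bump_eq1// (_ : zoom _ _ = 0) ?normr0//.
rewrite /center; case: xgetP => [p -> //|h].
have [|p pE] := @zoom_onto (prefix_of t m) 0; first by rewrite normr0.
by have := h p.
Qed.

Lemma prefix_of_separates (t t' : nat -> bool) : t != t' ->
  exists n, forall m, (n <= m)%N -> prefix_of t m != prefix_of t' m.
Proof.
move=> tt'; have [k kE] : exists k, t k != t' k.
  apply: contrapT => h; move/eqP: tt'; apply; apply/funext => k.
  by apply/eqP; apply: contrapT => /negP hk; apply: h; exists k.
exists k.+1 => m /subnKC <-; elim: (m - k.+1)%N => [|j ih].
  by rewrite addn0 /= eqseq_cons negb_and kE.
by rewrite addnS /= eqseq_cons negb_and ih orbT.
Qed.

Lemma sum_bump_disjoint (l : seq (seq bool)) n p :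
  uniq l -> (forall s, s \in l -> size s = n) -> \sum_(s <- l) bump s p <= 1.
Proof.
elim: l => [|s l ih] /=; first by rewrite big_nil.
move=> /andP[sl ul] ls; rewrite big_cons.
have [->|h] := eqVneq (bump s p) 0.
  by rewrite add0r ih// => r rl; apply: ls; rewrite inE rl orbT.
rewrite big_seq big1 ?addr0 ?bump_le1// => r rl; apply: bump_disjoint h.
  by rewrite !ls ?inE ?eqxx ?rl ?orbT.
by apply: contraNneq sl => ->.
Qed.

(** Bumps decrease along a branch, so the absolute increments telescope to a difference of two
    values in [[0, 1]]. *)
Lemma sum_bump_increments t (i : nat -> nat) p : {homo i : n m / (n <= m)%N} ->
  forall n, \sum_(0 <= k < n)
    `|bump (prefix_of t (i k.+1)) p - bump (prefix_of t (i k)) p| <= 1.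
Proof.
move=> imono n.
suff : \sum_(0 <= k < n) `|bump (prefix_of t (i k.+1)) p - bump (prefix_of t (i k)) p| =
    bump (prefix_of t (i 0%N)) p - bump (prefix_of t (i n)) p.
  move=> ->; have := bump_le1 (prefix_of t (i 0%N)) p.
  by have := bump_ge0 (prefix_of t (i n)) p; lra.
elim: n => [|n ih]; first by rewrite big_nil subrr.
rewrite big_nat_recr//= {}ih ler0_norm; last first.
  by rewrite subr_le0; apply: bump_prefix_le; exact: imono.
lra.
Qed.

End Bumps.

(** * Functionals norming along a branch *)

Section Embedding.
Variables (R : realType) (X : banachLatticeType R) (T : {linear C01 R -> X}).
Local Notation C := (C01 R).
Local Notation I := (unit_itv R).

(** Every signed sum is the image under [T] of a function of norm at most 1. The induction moves the
    head [f], with either sign, into [g], which preserves the pointwise bound. *)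
Lemma norm_sgnavg (M : R) (l : seq C) (g : C) : 0 <= M ->
  (forall f, `|T f| <= M * `|f|) ->
  (forall p, `|g p| + \sum_(f <- l) `|f p| <= 1) ->
  `|sgnavg (map T l) (T g)| <= M.
Proof.
move=> M0 TM; elim: l g => [|f l ih] g gl.
  rewrite [sgnavg _ _]/(modulus (T g)) norm_modulus.
  apply: le_trans (TM g) _; rewrite ler_piMr//.
  by apply: C01_norm_le => p; have := gl p; rewrite big_nil addr0.
rewrite /= -raddfD -raddfB normrZ ger0_norm ?invr_ge0//.
have h (h : C) : (forall p, `|h p| <= `|g p| + `|f p|) -> `|sgnavg (map T l) (T h)| <= M.
  move=> hgf; apply: ih => p; apply: le_trans (gl p); rewrite big_cons addrA.
  by rewrite lerD2r.
have hD := h (g + f) (fun p => ler_normD (g p) (f p)).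
have hB := h (g - f) (fun p => ler_normB (g p) (f p)).
rewrite mulrC ler_pdivrMr//; apply: le_trans (ler_normD _ _) _.
by rewrite mulrDr mulr1 lerD.
Qed.

Variable e : X.
Local Notation V := (ideal e).

Lemma val_sgnavg (l : seq V) (x : V) :
  val (sgnavg l x) = sgnavg (map val l) (val x).
Proof.
elim: l x => [//|a l ih] x.
have -> : val (sgnavg (a :: l) x) =
    2^-1 *: (val (sgnavg l (x + a)) + val (sgnavg l (x - a))) by [].
by rewrite !ih.
Qed.

Definition dominated_functional (s : V -> R) :=
  [/\ forall v w, s (v + w) = s v + s w, forall (c : R) v, s (c *: v) = c * s v,
      forall v, vle 0 v -> 0 <= s v & forall v, s v <= `|val v|].

Section NormingFunctional.
Variables (m : R) (t : nat -> bool) (y : seq bool -> V).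
Hypotheses (m0 : 0 < m) (Tm : forall f, m * `|f| <= `|T f|).
Hypothesis yT : forall s, val (y s) = T (bump R s).

(* [s v >= m * a] has to hold for all [W v a]; convexity of this set of
   constraints is what Hahn-Banach needs. *)
Let W (v : V) (a : R) := 0 <= a /\ exists (f : C) (N : nat),
  (forall n, (N <= n)%N -> f (center R (prefix_of t n)) = a) /\
  vle (modulus (T f)) (val v).

Let W0 : W 0 0.
Proof. by split=> //; exists 0, 0%N; rewrite raddf0 modulus_id vle_refl. Qed.

Let WD v w a b : W v a -> W w b -> W (v + w) (a + b).
Proof.
move=> [a0 [f [N [fa fv]]]] [b0 [g [N' [gb gw]]]]; split; first exact: addr_ge0.
exists (f + g), (maxn N N'); split.
  by move=> n; rewrite geq_max => /andP[/fa <- /gb <-].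
by rewrite raddfD; apply: vle_trans (modulusD _ _) _; exact: vleD.
Qed.

Let WZ (c : R) v a : 0 <= c -> W v a -> W (c *: v) (c * a).
Proof.
move=> c0 [a0 [f [N [fa fv]]]]; split; first exact: mulr_ge0.
exists (c *: f), N; split; first by move=> n /fa <-.
rewrite linearZ; apply: vle_trans (modulusZ_le _ _) _.
by rewrite ger0_norm// vleZ2l.
Qed.

Let pos (v : V) := vjoin v 0.

Let pos0 v : vle v 0 -> pos v = 0.
Proof. by move=> v0; apply: vle_anti; rewrite vle_joinr vleUx v0 vle_refl. Qed.

(** The constraints are consistent, and this is where the lower bound on [T] enters: [m * a] is at
    most the norm of [T f], while the modulus of [T f] is below [v], itself below
    [modulus x + pos (x + v)]. *)
Let W_ge x v a : W v a -> - `|val x| <= `|val (pos (x + v))| - m * a.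
Proof.
move=> [a0 [f [N [fa fv]]]]; rewrite lerBrDr addrC lerBlDr.
have h1 : m * a <= `|T f|.
  apply: le_trans (Tm f); apply: ler_wpM2l; first exact: ltW.
  have := C01_norm_ge f (center R (prefix_of t N)); rewrite fa//.
  exact: le_trans (ler_norm a).
apply: (le_trans h1); rewrite addrC -(norm_modulus (val x)).
apply: le_trans (ler_normD _ _); apply: norm_le_modulus. apply: vle_trans fv _.
rewrite -val_modulus -val_idealD val_vle -[v in vle v _](addKr x).
by apply: vleD; [exact: vleN_modulus | exact: vle_joinl].
Qed.

Let E x := [set r | exists v a, W v a /\ r = `|val (pos (x + v))| - m * a].

(** A linear functional below [q] is below the norm of the positive part (take [v = 0]), hence
    positive and dominated; it is at least [m * a] at [v] whenever [W v a] (take [x = - v]). *)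
Let q x := inf (E x).

Let E_inf x : has_inf (E x).
Proof.
split; first by exists (`|val (pos (x + 0))| - m * 0), 0, 0.
by exists (- `|val x|) => _ [v [a [/W_ge h ->]]].
Qed.

Let q_le x v a : W v a -> q x <= `|val (pos (x + v))| - m * a.
Proof. by move=> va; apply: ge_inf; [case: (E_inf x) | exists v, a]. Qed.

Let q_near x (d : R) : 0 < d ->
  exists v a, W v a /\ `|val (pos (x + v))| - m * a < q x + d.
Proof.
by move=> d0; have [_ [v [a [va ->]]]] := inf_adherent d0 (E_inf x); exists v, a.
Qed.

Let qZ (c : R) x : 0 < c -> q (c *: x) <= c * q x.
Proof.
move=> c0; apply/ler_addgt0Pr => d d0.
have [v [a [va xv]]] := q_near x (divr_gt0 d0 c0).
apply: le_trans (q_le _ (WZ (ltW c0) va)) _.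
apply: (@le_trans _ _ (c * (`|val (pos (x + v))| - m * a))).
  rewrite mulrBr [m * _]mulrCA lerD2r -scalerDr.
  have -> : c * `|val (pos (x + v))| = `|val (c *: pos (x + v))|.
    by rewrite val_idealZ normrZ gtr0_norm.
  apply: norm_le_modulus; rewrite -val_modulus val_vle modulus_id ?vle_joinr//.
  by rewrite vleUx vscaler_ge0 ?ltW ?vle_joinr// vleZ2l ?ltW ?vle_joinl.
apply: le_trans (ler_wpM2l (ltW c0) (ltW xv)) _.
by rewrite mulrDr [c * (d / c)]mulrC divfK ?gt_eqF.
Qed.

Let q_subfun : subfun (fun _ _ _ : V => False) q.
Proof.
split=> //; split=> [x x'|c x].
  apply/ler_addgt0Pr => d d0.
  have [v [a [va xv]]] := q_near x (divr_gt0 d0 (ltr0Sn R 1)).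
  have [w [b [wb xw]]] := q_near x' (divr_gt0 d0 (ltr0Sn R 1)).
  apply: le_trans (q_le _ (WD va wb)) _.
  have : `|val (pos (x + x' + (v + w)))| <=
      `|val (pos (x + v))| + `|val (pos (x' + w))|; last by lra.
  apply: le_trans (ler_normD _ _); rewrite -val_idealD.
  apply: norm_le_modulus; rewrite -val_modulus val_vle modulus_id ?vle_joinr//.
  rewrite vleUx addrACA vleD ?vle_joinl//=.
  by rewrite -[X in vle X _]addr0 vleD ?vle_joinr.
rewrite le_eqVlt => /predU1P[<-|c0].
  rewrite scale0r mul0r; apply/le_anti/andP; split.
    apply: le_trans (q_le _ W0) _; rewrite addr0 mulr0 subr0.
    by rewrite pos0 ?vle_refl// normr0.
  apply: lb_le_inf; first by case: (E_inf 0).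
  by move=> _ [v [a [/(W_ge 0) h ->]]]; rewrite normr0 oppr0 in h.
apply/le_anti; rewrite qZ//=.
have := @qZ c^-1 (c *: x); rewrite invr_gt0 => /(_ c0).
by rewrite scalerA mulVf ?gt_eqF// scale1r -ler_pdivlMl ?invr_gt0// invrK.
Qed.

Lemma norming_functional : exists s, dominated_functional s /\
  forall n, m <= s (modulus (y (prefix_of t n))).
Proof.
have [//|l [lD lZ lq _]] := subfun_dominated _ q_subfun.
have lpos x : l x <= `|val (pos x)|.
  apply: le_trans (lq x) _; apply: le_trans (q_le x W0) _.
  by rewrite addr0 mulr0 subr0.
have lN x : l (- x) = - l x by rewrite -scaleN1r lZ mulN1r.
exists l; split; first split=> //.
- move=> v v0; rewrite -oppr_le0 -lN; apply: le_trans (lpos _) _.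
  by rewrite pos0 ?normr0// -vleN2 opprK oppr0.
- move=> v; apply: le_trans (lpos v) _; rewrite -(norm_modulus (val v)).
  apply: norm_le_modulus; rewrite -!val_modulus val_vle modulus_id ?vle_joinr//.
  by rewrite vleUx vle_modulus modulus_ge0.
- move=> n; rewrite -lerN2 -lN; apply: le_trans (lq _) _.
  (* The bump of a prefix equals 1 at the centers of all longer prefixes. *)
  have y1 : W (modulus (y (prefix_of t n))) 1.
    split=> //; exists (bump R (prefix_of t n)), n; split=> [k|].
      exact: bump_center.
    by rewrite val_modulus yT vle_refl.
  by apply: le_trans (q_le _ y1) _; rewrite addNr pos0 ?vle_refl// normr0 mulr1 sub0r.
Qed.

End NormingFunctional.
End Embedding.

(** * Big elements and their splitting *)

Lemma uncountable_branches : ~ countable [set: nat -> bool].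
Proof.
move=> /countable_injP[f finj].
(* Cantor's diagonal argument, with [g] inverting the supposed injection [f]. *)
pose g n := xget (fun _ => false) [set t | f t = n].
pose d n := ~~ g n n.
have gd : g (f d) = d.
  by rewrite /g; case: xgetP => [t _ /= /finj -> //|/(_ d)/(_ erefl)]; rewrite ?inE.
have /(_ (f d)) : forall n, d n = ~~ g n n by [].
by rewrite gd; case: (d (f d)).
Qed.

Lemma no_linear_growth (R : realType) (d M : R) :
  (forall n : nat, n%:R * d <= 2 * Num.sqrt n%:R * M) -> d <= 0.
Proof.
move=> h; rewrite leNgt; apply/negP => d0.
(* At [n = j * j] the hypothesis reads [j * d <= 2 * M], which fails for this [j]. *)
pose j := (Num.trunc (2 * M / d)).+1.
have j0 : 0 < j%:R :> R by rewrite ltr0n.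
have := h (j * j)%N; rewrite natrM -expr2 sqrtr_sqr (ger0_norm (ltW j0)).
apply/negP; rewrite -ltNge expr2 [2 * _]mulrC -!mulrA ltr_pM2l//.
by rewrite -ltr_pdivrMr// truncnS_gt.
Qed.

Section DominatedFunctional.
Variables (R : realType) (X : banachLatticeType R) (e : X).
Hypothesis e0 : vle 0 e.
Local Notation V := (ideal e).
Variable s : V -> R.
Hypothesis sP : dominated_functional s.

Lemma domfD v w : s (v + w) = s v + s w. Proof. by case: sP. Qed.
Lemma domfZ (c : R) v : s (c *: v) = c * s v. Proof. by case: sP. Qed.
Lemma domf0 : s 0 = 0.
Proof. by rewrite -(scale0r (0 : V)) domfZ mul0r. Qed.
Lemma domfN v : s (- v) = - s v.
Proof. by rewrite -scaleN1r domfZ mulN1r. Qed.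
Lemma domfB v w : s (v - w) = s v - s w.
Proof. by rewrite domfD domfN. Qed.
Lemma domf_ge0 v : vle 0 v -> 0 <= s v. Proof. by case: sP => _ _ h _; exact: h. Qed.
Lemma domf_norm v : s v <= `|val v|. Proof. by case: sP. Qed.
Lemma domf_le v w : vle v w -> s v <= s w.
Proof. by rewrite -vsubr_ge0 => /domf_ge0; rewrite domfB subr_ge0. Qed.

Let uP := ideal_order_unit e0.
Let uA := @ideal_archimedean _ _ _ e0.

(** The real inequality holds at every lattice homomorphism, hence in the ideal; positivity and
    domination of [s] carry it over to norms. *)
Lemma domf_sum_modulus (l : seq V) :
  \sum_(a <- l) s (modulus a) <= 2 * Num.sqrt (size l)%:R * `|val (sgnavg l 0)|.
Proof.
rewrite -(big_morph s domfD domf0).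
apply: (@le_trans _ _ (s ((2 * Num.sqrt (size l)%:R) *: sgnavg l 0))).
  apply: domf_le; apply: (vle_pointwise uP uA) => f fP fu.
  rewrite (big_morph f (latfD fP) (latf0 fP)) (latfZ fP) (latf_sgnavg _ _ fP).
  rewrite (latf0 fP); under eq_bigr do rewrite (latf_modulus fP).
  by have := sum_abs_sgnavg (map f l); rewrite big_map size_map.
by rewrite domfZ ler_wpM2l ?mulr_ge0 ?sqrtr_ge0 ?domf_norm.
Qed.

Variables (y : seq bool -> V) (M : R).

(* Otherwise [n] increments, each of [s]-mass at least [d], have sign averages of
   norm at most [M], although these must grow like [sqrt n]. *)
Lemma branch_cauchy (t : nat -> bool) :
  (forall i n, {homo i : j k / (j <= k)%N} ->
    `|val (sgnavg [seq y (prefix_of t (i k.+1)) - y (prefix_of t (i k))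
       | k <- index_iota 0 n] 0)| <= M) ->
  forall d : R, 0 < d -> exists N, forall n, (N <= n)%N ->
    s (modulus (y (prefix_of t n) - y (prefix_of t N))) <= d.
Proof.
move=> yM d d0; apply: contrapT => /forallNP h.
have {}h N : exists n, (N <= n)%N /\ d < s (modulus (y (prefix_of t n) - y (prefix_of t N))).
  have /existsNP[n /not_implyP[Nn /negP]] := h N.
  by rewrite -ltNge => hn; exists n.
have /choice[g gP] := h.
pose i k := iter k g 0%N.
have ihomo : {homo i : j k / (j <= k)%N}.
  apply: homo_leq => [//|n j k|k]; first exact: leq_trans.
  exact: (gP _).1.
have : d <= 0; last by rewrite leNgt d0.
apply: (@no_linear_growth _ _ M) => n.
pose l := [seq y (prefix_of t (i k.+1)) - y (prefix_of t (i k)) | k <- index_iota 0 n].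
have := domf_sum_modulus l; rewrite size_map size_iota subn0 => hl.
apply: (@le_trans _ _ (2 * Num.sqrt n%:R * `|val (sgnavg l 0)|)); last first.
  by rewrite ler_wpM2l ?mulr_ge0 ?sqrtr_ge0 ?yM.
apply: le_trans hl; rewrite big_map.
apply: (@le_trans _ _ (\sum_(0 <= k < n) d)).
  by rewrite sumr_const_nat subn0 mulr_natl.
by apply: ler_sum => k _; apply/ltW; exact: (gP _).2.
Qed.

(** Otherwise uncountably many branches of [S] share one threshold [j.+1%:R^-1]. Any [K] of them
    have distinct prefixes at a deep level, where the sign averages are bounded by [M] although the
    total mass grows linearly in [K]. *)
Lemma small_branch (S : set (nat -> bool)) :
  (forall l n, uniq l -> (forall r, r \in l -> size r = n) ->
    `|val (sgnavg (map y l) 0)| <= M) ->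
  ~ countable S ->
  exists2 t, S t & forall d : R, 0 < d -> forall k, exists2 n, (k <= n)%N &
    s (modulus (y (prefix_of t n))) < d.
Proof.
move=> yM Sunc; apply: contrapT => h.
pose Sj j := [set t | S t /\ forall n, (j <= n)%N ->
  j.+1%:R^-1 <= s (modulus (y (prefix_of t n)))].
have [j Sjunc] : exists j, ~ countable (Sj j).
  apply: contrapT => /forallNP Sjc; apply: Sunc.
  apply: (@sub_countable _ _ _ (\bigcup_j Sj j)); last first.
    by apply: bigcup_countable => // j _; exact: contrapT (Sjc j).
  apply: subset_card_le => t St.
  have [d [d0 [k hk]]] : exists d : R, 0 < d /\ exists k, forall n, (k <= n)%N ->
      d <= s (modulus (y (prefix_of t n))).
    apply: contrapT => hd; apply: h; exists t => // d d0 k.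
    apply: contrapT => hk; apply: hd; exists d; split => //; exists k => n kn.
    by rewrite leNgt; apply/negP => hn; apply: hk; exists n.
  (* A single index encodes both the level [k] and the mass [d], so that countably many sets [Sj j]
     cover [S]. *)
  exists (maxn k (Num.trunc d^-1)) => //; split=> // n.
  rewrite geq_max => /andP[kn dn]; apply: le_trans (hk n kn).
  rewrite invf_ple ?posrE ?ltr0n//; apply/ltW/(lt_le_trans (truncnS_gt _)).
  by rewrite ler_nat ltnS leq_maxr.
have Sjinf : infinite_set (Sj j) by move=> /finite_set_countable.
have : j.+1%:R^-1 <= 0 :> R; last by rewrite leNgt invr_gt0 ltr0n.
apply: (@no_linear_growth _ _ M) => K.
have [l [ul lS lK]] : exists l : seq (nat -> bool),
    [/\ uniq l, forall t, t \in l -> Sj j t & size l = K].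
  have [B BS BK] := infinite_set_fset K Sjinf.
  exists (take K (finmap.enum_fset B)); split.
  - by rewrite take_uniq// finmap.fset_uniq.
  - by move=> t /mem_take; exact: BS.
  - by rewrite size_take; case: ltngtP BK => // ->.
have [N NP] : exists N, forall n, (N <= n)%N -> uniq [seq prefix_of t n | t <- l].
  elim: l ul {lS lK} => [|t l ih] /=; first by exists 0%N.
  move=> /andP[tl /ih[N NP]].
  suff [N' N'P] : exists N', forall n, (N' <= n)%N ->
      prefix_of t n \notin [seq prefix_of t n | t <- l].
    exists (maxn N N') => n; rewrite geq_max => /andP[Nn N'n].
    by rewrite N'P//= NP.
  elim: l tl {ih N NP} => [|r l ih] /=; first by exists 0%N.
  rewrite inE negb_or => /andP[/prefix_of_separates[N1 h1] /ih[N2 h2]].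
  exists (maxn N1 N2) => n; rewrite geq_max => /andP[n1 n2].
  by rewrite inE negb_or h1//= h2.
pose n := maxn N j; pose ly := [seq y r | r <- [seq prefix_of t n | t <- l]].
have := domf_sum_modulus ly; rewrite !size_map lK => hl.
apply: (@le_trans _ _ (2 * Num.sqrt K%:R * `|val (sgnavg ly 0)|)); last first.
  rewrite ler_wpM2l ?mulr_ge0 ?sqrtr_ge0// (yM _ n) ?NP ?leq_maxl//.
  by move=> r /mapP[t _ ->]; rewrite size_prefix_of.
apply: le_trans hl; rewrite !big_map.
rewrite (_ : K%:R * _ = \sum_(t <- l) j.+1%:R^-1); last first.
  by rewrite big_const_seq count_predT iter_addr_0 lK mulr_natl.
rewrite !big_seq; apply: ler_sum => t /lS[_ ht].
by apply: ht; exact: leq_maxr.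
Qed.

End DominatedFunctional.

Ltac minmax := repeat match goal with
  | |- context [Order.min ?a ?b] => case: (leP a b)
  | |- context [Order.max ?a ?b] => case: (leP a b)
  | |- context [`|?a|] => case: (ger0P a) end; intros; lra.

Section Splitting.
Variables (R : realType) (X : banachLatticeType R) (e : X).
Hypothesis e0 : vle 0 e.
Local Notation V := (ideal e).
Variables (y : seq bool -> V) (s : (nat -> bool) -> V -> R) (M m : R).
Hypothesis yM_increments : forall t i n, {homo i : j k / (j <= k)%N} ->
  `|val (sgnavg [seq y (prefix_of t (i k.+1)) - y (prefix_of t (i k))
     | k <- index_iota 0 n] 0)| <= M.
Hypothesis yM_level : forall l n, uniq l -> (forall r, r \in l -> size r = n) ->
  `|val (sgnavg (map y l) 0)| <= M.
Hypothesis sP : forall t, dominated_functional (s t).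
Hypothesis m0 : 0 < m.
Hypothesis sm : forall t n, m <= s t (modulus (y (prefix_of t n))).

Let u t n := modulus (y (prefix_of t n)).

(** The gap [d] spells out that the lower limit strictly exceeds [m / 4]; it is the budget from
    which cutting and splitting are paid. *)
Definition branches (h : V) : set (nat -> bool) := [set t | exists2 d : R, 0 < d &
  exists N, forall n, (N <= n)%N -> m / 4 + d <= s t (vmeet h (u t n))].

Definition big h := ~ countable (branches h).

Lemma bigcup_big (h : V) (g : nat -> V) (B : set (nat -> bool)) :
  B `<=` \bigcup_n branches (g n) -> ~ countable B -> exists n, big (g n).
Proof.
move=> Bg Bunc; apply: contrapT => /forallNP gc; apply: Bunc.
apply: sub_countable (subset_card_le Bg) _.
by apply: bigcup_countable => // n _; exact: contrapT (gc n).
Qed.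

Let unit_pointwise (k : R) (v w : V) : 0 < k ->
  (forall f, lattice_functional f -> f (k *: ideal_unit e0) = 1 -> f v <= f w) ->
  vle v w.
Proof.
move=> k0; apply: vle_pointwise.
  exact: order_unitZ (ideal_order_unit e0).
exact: (archimedean_unitZ k0 (@ideal_archimedean _ _ _ e0)).
Qed.

(** On each branch the moduli from a Cauchy index [N] on stay, up to mass [m / 2], above [u t N],
    which lies below an integer multiple of [e]. One of these countably many multiples serves
    uncountably many branches. *)
Lemma big_unit : exists2 k : R, 0 < k & big (k *: ideal_unit e0).
Proof.
suff [n nb] : exists n, big (n.+1%:R *: ideal_unit e0) by exists n.+1%:R.
apply: (@bigcup_big 0 (fun n => n.+1%:R *: ideal_unit e0) setT); last first.
  exact: uncountable_branches.
move=> t _; have m2 : 0 < m / 2 by rewrite divr_gt0.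
have [N hN] := branch_cauchy e0 (sP t) (yM_increments t) m2.
have [c uc] := (ideal_order_unit e0).2 (u t N).
exists (Num.trunc c) => //; exists (m / 4); first by rewrite divr_gt0.
exists N => n Nn.
have : vle (u t N - modulus (y (prefix_of t n) - y (prefix_of t N)))
    (vmeet ((Num.trunc c).+1%:R *: ideal_unit e0) (u t n)).
  apply: (unit_pointwise ltr01) => f fP; rewrite scale1r => fu.
  have := latf_le fP uc; rewrite !(latfE fP) fu !mulr1.
  have : c < (Num.trunc c).+1%:R by exact: truncnS_gt.
  move: _.+1%:R => c' cc'; minmax.
move=> /(domf_le (sP t)); rewrite (domfB (sP t)).
have := hN n Nn; have := sm t N; rewrite -/(u t N); lra.
Qed.

Variable k : R.
Hypothesis k0 : 0 < k.
Variable E : V.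
Hypothesis EE : E = k *: ideal_unit e0.

Let ple v w : (forall f, lattice_functional f -> f E = 1 -> f v <= f w) -> vle v w.
Proof. by rewrite EE; exact: unit_pointwise. Qed.

(** Where this is positive, [h] exceeds [d] times the unit: this is the room between consecutive
    levels of the tree. *)
Definition cut (h : V) (d : R) : V := vjoin (h - d *: E) 0.

(** Cutting at [d'] costs at most [d' * s t E], so each branch of [h] tolerates some cut at
    [j.+1%:R^-1]; one such cut keeps uncountably many branches. *)
Lemma big_cut h : vle 0 h -> big h -> exists2 d, 0 < d & big (cut h d).
Proof.
move=> h0 hb.
suff [n nb] : exists n, big (cut h n.+1%:R^-1) by exists n.+1%:R^-1; rewrite ?invr_gt0.
apply: bigcup_big hb => // t [d d0 [N hN]].
exists (Num.trunc (2 * s t E / d)) => //; exists (d / 2); first by rewrite divr_gt0.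
exists N => n Nn; set j := Num.trunc _.
have : vle (vmeet h (u t n) - j.+1%:R^-1 *: E) (vmeet (cut h j.+1%:R^-1) (u t n)).
  apply: ple => f fP fE; have := latf_ge0 fP h0.
  have : 0 <= j.+1%:R^-1 :> R by rewrite invr_ge0.
  by rewrite !(latfE fP) fE mulr1; move: (_^-1) (f h) (f _) => *; minmax.
move=> /(domf_le (sP t)); rewrite (domfB (sP t)) (domfZ (sP t)).
have : j.+1%:R^-1 * s t E <= d / 2.
  rewrite mulrC ler_pdivrMr ?ltr0n// mulrC -ler_pdivrMr ?divr_gt0//.
  by rewrite invfM invrK mulrA [_ * 2]mulrC mulrA ltW// truncnS_gt.
move: (j.+1%:R^-1) => j'; have := hN n Nn; lra.
Qed.

(* [s t] sees [h] where [y (prefix_of t n)] is large, whereas [s t'] barely charges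
   that region. *)
Lemma big_split h : vle 0 h -> vle h E -> big h ->
  exists g0 g1, [/\ vle 0 g0 /\ vle 0 g1, vle g0 h, vle g1 h, vmeet g0 g1 = 0 &
    big g0 /\ big g1].
Proof.
move=> h0 hE hb.
(* For [a = (r, i)], [g1 a] lives where the modulus of [y r] exceeds [1 / (i + 1)], and [g0 a] where
   [i + 1] times that modulus is below [h], thus below 1. The index set is countable. *)
pose g1 (a : seq bool * nat) := cut (vmeet h (modulus (y a.1))) a.2.+1%:R^-1.
pose g0 (a : seq bool * nat) := vjoin (h - a.2.+1%:R *: modulus (y a.1)) 0.
(* The branches seeing some candidate that is not big form a countable set; once they are discarded,
   a candidate seen by one branch of [S] is automatically big. *)
pose small (g : seq bool * nat -> V) :=
  \bigcup_(a in [set a | countable (branches (g a))]) branches (g a).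
have smallP g : countable (small g) by exact: bigcup_countable.
pose S := branches h `\` (small g0 `|` small g1).
have Sunc : ~ countable S.
  move=> Sc; apply: hb.
  pose B (i : nat) := match i with 0%N => S | 1%N => small g0 | _ => small g1 end.
  apply: (@sub_countable _ _ _ (\bigcup_i B i)); last first.
    by apply: bigcup_countable => // -[|[|i]] _; [exact: Sc|exact: smallP|exact: smallP].
  apply: subset_card_le => t ht.
  have [t0|t0] := pselect (small g0 t); first by exists 1%N.
  have [t1|t1] := pselect (small g1 t); first by exists 2%N.
  by exists 0%N => //; split => // -[].
have big_of g a t : S t -> (forall r, small g r -> (small g0 `|` small g1) r) ->
    branches (g a) t -> big (g a).
  by move=> [_ St] gs gt gc; apply: St; apply: gs; exists a.
have [t' St'] : exists t', S t'.
  apply: contrapT => /forallNP S0; apply: Sunc; rewrite (_ : S = set0)//.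
  by rewrite -subset0 => r /S0.
have [t St tsmall] := small_branch e0 (sP t') yM_level Sunc.
have [[d d0 [N hN]] tnot] := St; have [[d' d'0 [N' hN']] t'not] := St'.
have sE0 r : 0 <= s r E.
  by apply: (domf_ge0 (sP r)); exact: vle_trans h0 hE.
(* The budget along [t]: out of the gap [d], the cut takes [d / 4] and two increments take [d / 8]
   each, which leaves at least [d / 4]. *)
have [i iE] : exists i : nat, i.+1%:R^-1 * s t E <= d / 4.
  exists (Num.trunc (s t E / (d / 4))).
  rewrite mulrC ler_pdivrMr ?ltr0n// mulrC -ler_pdivrMr ?divr_gt0//.
  by rewrite ltW// truncnS_gt.
have i0 : 0 < i.+1%:R :> R by rewrite ltr0n.
have d8 : 0 < d / 8 by rewrite divr_gt0.
have [N1 hN1] := branch_cauchy e0 (sP t) (yM_increments t) d8.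
(* The node is chosen only after [i]: far along [t], [i + 1] times its mass under [s t'] is at most
   [d' / 2], half the gap of [t']. *)
have ie0 : 0 < d' / 2 / i.+1%:R by rewrite divr_gt0// divr_gt0.
have [n Nn un] := tsmall _ ie0 (maxn N N1); rewrite -/(u t n) in un.
pose a := (prefix_of t n, i).
have b1 : branches (g1 a) t.
  exists (d / 4); first by rewrite divr_gt0.
  exists (maxn N N1) => p; rewrite geq_max => /andP[Np N1p].
  move: Nn; rewrite geq_max => /andP[Nn N1n].
  have : vle (vmeet h (u t p) - modulus (y (prefix_of t n) - y (prefix_of t N1))
      - modulus (y (prefix_of t p) - y (prefix_of t N1)) - i.+1%:R^-1 *: E)
      (vmeet (g1 a) (u t p)).
    apply: ple => f fP fE; have := latf_ge0 fP h0.
    have : 0 <= i.+1%:R^-1 :> R by rewrite invr_ge0.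
    rewrite !(latfE fP) fE mulr1 /=.
    move: (_^-1) (f h) (f (y (prefix_of t n))) (f (y (prefix_of t N1)))
      (f (y (prefix_of t p))) => i' x1 x2 x3 x4.
    have : `|x4| <= `|x2| + `|x2 - x3| + `|x4 - x3|.
      rewrite {1}(_ : x4 = x2 - (x2 - x3) + (x4 - x3)); last by ring.
      by apply: le_trans (ler_normD _ _) _; rewrite lerD2r ler_normB.
    have := normr_ge0 (x2 - x3); have := normr_ge0 (x4 - x3).
    move: `|x2| `|x4| `|x2 - x3| `|x4 - x3| => A C D1 D2 h1 h2 h3 h4 h5.
    rewrite le_min; apply/andP; split; last by move: h1 h2 h3 h4 h5; minmax.
    by rewrite le_max; apply/orP; left; move: h1 h2 h3 h4 h5; minmax.
  move=> /(domf_le (sP t)); rewrite !(domfB (sP t)) (domfZ (sP t)).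
  have := hN _ Np; have := hN1 _ N1p; have := hN1 _ N1n.
  move: (_^-1 * s t E) iE => r; lra.
have b0 : branches (g0 a) t'.
  exists (d' / 2); first by rewrite divr_gt0.
  exists N' => p N'p.
  have : vle (vmeet h (u t' p) - i.+1%:R *: u t n) (vmeet (g0 a) (u t' p)).
    apply: ple => f fP fE; have := latf_ge0 fP h0.
    rewrite !(latfE fP) /=; move: i0.
    have : 0 <= i.+1%:R * `|f (y (prefix_of t n))| by rewrite mulr_ge0.
    move: (_ * _) (f h) `|f (y (prefix_of t' p))| (normr_ge0 (f (y (prefix_of t' p)))).
    move=> x1 x2 x3 x30 x10 _ x20; rewrite le_min; apply/andP; split; last by minmax.
    by rewrite le_max; apply/orP; left; minmax.
  move=> /(domf_le (sP t')); rewrite !(domfB (sP t')) (domfZ (sP t')).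
  have : i.+1%:R * s t' (u t n) <= d' / 2.
    by rewrite mulrC -ler_pdivlMr// ltW.
  have := hN' _ N'p; lra.
exists (g0 a), (g1 a); split.
- by split; exact: vle_joinr.
- apply: ple => f fP fE; have := latf_ge0 fP h0; rewrite !(latfE fP) /= => h0'.
  have : 0 <= i.+1%:R * `|f (y (prefix_of t n))| by rewrite mulr_ge0.
  by move: (_ * _) => x1; rewrite ge_max h0' andbT => ?; lra.
- apply: ple => f fP fE; have := latf_ge0 fP h0; rewrite !(latfE fP) fE mulr1 /= => h0'.
  have : 0 <= i.+1%:R^-1 :> R by rewrite invr_ge0.
  move: (_^-1) `|_| => x1 x2; rewrite ge_max h0' andbT; minmax.
- have p0 f : lattice_functional f -> f E = 1 -> f (vmeet (g0 a) (g1 a)) = 0.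
    move=> fP fE; have := latf_le fP hE; rewrite !(latfE fP) fE mulr1 /=.
    move: (f h) (f (y (prefix_of t n))) => x1 x2 hx1.
    have [x2i|x2i] := leP (i.+1%:R^-1) `|x2|.
      have : 1 <= i.+1%:R * `|x2| by rewrite mulrC -ler_pdivrMr ?mul1r.
      move=> h1; rewrite [Num.max (x1 - _) 0]max_r; last by rewrite subr_le0 (le_trans hx1).
      by rewrite min_l// le_max lexx orbT.
    rewrite [Num.max (_ - _^-1) 0]max_r; last by rewrite subr_le0 ge_min (ltW x2i) orbT.
    by rewrite min_r// le_max lexx orbT.
  apply: vle_anti; apply/andP; split; apply: ple => f fP fE;
    by rewrite (latf0 fP) p0.
- split; [apply: (big_of g0 a t') => // | apply: (big_of g1 a t) => //].
  + by move=> r; left.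
  + by move=> r; right.
Qed.

Lemma big_norm h : big h -> m / 4 <= `|val h|.
Proof.
move=> hb; have [t [d d0 [N hN]]] : exists t, branches h t.
  apply: contrapT => /forallNP S0; apply: hb; rewrite (_ : branches h = set0)//.
  by rewrite -subset0 => r /S0.
have := hN _ (leqnn N); have := domf_le (sP t) (vle_meetl h (u t N)).
have := domf_norm (sP t) h; lra.
Qed.

End Splitting.

(** * The coordinate of a dyadic tree *)

Section DyadicTree.
Variables (R : realType) (X : banachLatticeType R) (e : X).
Hypothesis e0 : vle 0 e.
Local Notation V := (ideal e).
Variables (k : R) (E : V).
Hypothesis k0 : 0 < k.
Hypothesis EE : E = k *: ideal_unit e0.
Variable big : V -> Prop.
Hypothesis big_cut : forall h, vle 0 h -> big h -> exists2 d, 0 < d & big (cut E h d).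
Hypothesis big_split : forall h, vle 0 h -> vle h E -> big h ->
  exists g0 g1, [/\ vle 0 g0 /\ vle 0 g1, vle g0 h, vle g1 h, vmeet g0 g1 = 0 &
    big g0 /\ big g1].
Hypothesis bigE : big E.

Let E0 : vle 0 E.
Proof. by rewrite EE vscaler_ge0 ?ltW//; exact: (ideal_order_unit e0).1. Qed.

(** The second component is a level at which the first can be cut and remain big; the children are
    found below that cut. *)
Definition node (a : V * R) :=
  [/\ vle 0 a.1, vle a.1 E, 0 < a.2 & big (cut E a.1 a.2)].

Lemma node_of h : vle 0 h -> vle h E -> big h -> exists d, node (h, d).
Proof. by move=> h0 hE /(big_cut h0)[d d0 hd]; exists d; split. Qed.

Lemma cut_ge0 h d : vle 0 (cut E h d). Proof. exact: vle_joinr. Qed.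

Lemma cut_le h d : vle 0 h -> 0 <= d -> vle (cut E h d) h.
Proof.
move=> h0 d0; rewrite vleUx h0 andbT -vsubr_ge0 opprB addrCA subrr addr0.
by rewrite vscaler_ge0.
Qed.

Lemma node_children a : node a -> exists b : bool -> V * R,
  [/\ forall i, node (b i), forall i, vle (b i).1 (cut E a.1 a.2) &
      vmeet (b false).1 (b true).1 = 0].
Proof.
move=> [a0 aE d0 abig].
have [||g0 [g1 [[g00 g10] g0a g1a g01 [b0 b1]]]] := big_split _ _ abig.
- exact: cut_ge0.
- by apply: vle_trans aE; rewrite cut_le// ltW.
have aE' : vle (cut E a.1 a.2) E by apply: vle_trans aE; rewrite cut_le// ltW.
have [d1 n1] := node_of g00 (vle_trans _ _ _ g0a aE') b0.
have [d2 n2] := node_of g10 (vle_trans _ _ _ g1a aE') b1.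
by exists (fun i => if i then (g1, d2) else (g0, d1)); split=> // -[].
Qed.

Lemma tree_exists : exists a : seq bool -> V * R,
  [/\ forall s, node (a s), forall i s, vle (a (i :: s)).1 (cut E (a s).1 (a s).2) &
      forall s, vmeet (a (false :: s)).1 (a (true :: s)).1 = 0].
Proof.
have [d0 nE] := node_of E0 (vle_refl E) bigE.
have /choice[c cP] : forall a : V * R, exists b : bool -> V * R, node a ->
    [/\ forall i, node (b i), forall i, vle (b i).1 (cut E a.1 a.2) &
      vmeet (b false).1 (b true).1 = 0].
  move=> a; have [/node_children[b bP]|na] := pselect (node a); first by exists b.
  (* A default for pairs that are not nodes; the tree never reaches it. *)
  by exists (fun _ => a).
pose a := fix a s := if s is i :: s' then c (a s') i else (E, d0).
have na s : node (a s) by elim: s => [//|i s /cP[h _ _]]; exact: h.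
exists a; split => // [i s|s]; last by have [] := cP _ (na s).
by have [_ h _] := cP _ (na s); exact: h.
Qed.

Section Coordinate.
Variable a : seq bool -> V * R.
Hypothesis a_node : forall s, node (a s).
Hypothesis a_child : forall i s, vle (a (i :: s)).1 (cut E (a s).1 (a s).2).
Hypothesis a_disjoint : forall s, vmeet (a (false :: s)).1 (a (true :: s)).1 = 0.

(* [w s] is [E] on the support of [core s] and vanishes off the support of [g s],
   so it can serve as a binary digit. *)
Let g s := (a s).1.
Let core s := cut E (a s).1 (a s).2.
Let w s := vmeet E ((a s).2^-1 *: g s).

(** The binary expansion read below [s], truncated after [n] digits. At each homomorphism at most
    one child is nonzero, so the recursive terms never add up, and [w (true :: s)] is the leading
    digit. *)
Fixpoint coord (n : nat) (s : seq bool) : V :=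
  if n is n'.+1 then
    2^-1 *: (coord n' (true :: s) + coord n' (false :: s) + w (true :: s))
  else 0.

(** The head of a word is its last digit, hence the weight [2^-1 ^+ size s]. *)
Fixpoint dyadic (s : seq bool) : R :=
  if s is i :: s' then dyadic s' + i%:R * 2^-1 ^+ (size s) else 0.

Section Pointwise.
Variable f : V -> R.
Hypotheses (fP : lattice_functional f) (fE : f E = 1).

Let g_ge0 s : 0 <= f (g s).
Proof. by apply: (latf_ge0 fP); case: (a_node s). Qed.

Let coreE s : f (core s) = Num.max (f (g s) - (a s).2) 0.
Proof. by rewrite !(latfE fP) fE mulr1. Qed.

Let d_gt0 s : 0 < (a s).2. Proof. by case: (a_node s). Qed.

Let wE s : f (w s) = Num.min 1 ((a s).2^-1 * f (g s)).
Proof. by rewrite !(latfE fP) fE. Qed.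

Let w_eq1 s : 0 < f (core s) -> f (w s) = 1.
Proof.
rewrite coreE wE lt_max ltxx orbF subr_gt0 => h; apply: min_l.
by rewrite mulrC ler_pdivlMr// mul1r ltW.
Qed.

Let w_ge0 s : 0 <= f (w s).
Proof. by rewrite wE le_min ler01 mulr_ge0// invr_ge0 ltW. Qed.

Let w_le1 s : f (w s) <= 1. Proof. by rewrite wE ge_min lexx. Qed.

Let w_eq0 s : f (g s) = 0 -> f (w s) = 0.
Proof. by rewrite wE => ->; rewrite mulr0 min_r. Qed.

Let core_ge0 s : 0 <= f (core s).
Proof. by rewrite coreE le_max lexx orbT. Qed.

Let child_le i s : f (g (i :: s)) <= f (core s).
Proof. exact: (latf_le fP (a_child i s)). Qed.

Let core_le s : f (core s) <= f (g s).
Proof. by apply: (latf_le fP); rewrite cut_le ?ltW//; case: (a_node s). Qed.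

Let child_eq0 s : f (g (true :: s)) = 0 \/ f (g (false :: s)) = 0.
Proof.
have := congr1 f (a_disjoint s); rewrite !(latfE fP).
by rewrite minEle -/(g _) -/(g _); case: ifP => _ h; [right|left].
Qed.

Let coordS n s : f (coord n.+1 s) =
  2^-1 * (f (coord n (true :: s)) + f (coord n (false :: s)) + f (w (true :: s))).
Proof. by rewrite /= !(latfD fP, latfZ fP). Qed.

Lemma coord_eq0 n s : f (core s) = 0 -> f (coord n s) = 0.
Proof.
elim: n s => [|n ih] s s0; first by rewrite (latf0 fP).
have c0 i : f (g (i :: s)) = 0 by apply/le_anti; rewrite g_ge0 -s0 child_le.
have cc0 i : f (core (i :: s)) = 0 by apply/le_anti; rewrite core_ge0 -(c0 i) core_le.
by rewrite coordS !ih ?w_eq0// !addr0 mulr0.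
Qed.

Let coord_off n i s : f (g (i :: s)) = 0 -> f (coord n (i :: s)) = 0.
Proof.
by move=> h; apply: coord_eq0; apply/le_anti; rewrite core_ge0 -h core_le.
Qed.

Lemma coord_itv n s : 0 <= f (coord n s) <= 1.
Proof.
elim: n s => [|n ih] s; first by rewrite (latf0 fP) lexx ler01.
have /andP[t0 t1] := ih (true :: s); have /andP[f0 f1] := ih (false :: s).
have := w_ge0 (true :: s); have := w_le1 (true :: s).
by rewrite coordS; case: (child_eq0 s) => h; rewrite (coord_off n h) ?(w_eq0 h) => *;
  apply/andP; split; lra.
Qed.

(** The leading digits cancel and only one child survives, so each level halves the difference. *)
Lemma coord_step n s : `|f (coord n.+1 s) - f (coord n s)| <= 2^-1 ^+ n.
Proof.
elim: n s => [|n ih] s.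
  by have /andP[? ?] := coord_itv 1 s; rewrite (latf0 fP) subr0 expr0 ger0_norm.
rewrite (coordS n.+1 s) (coordS n s) -mulrBr normrM ger0_norm ?invr_ge0// exprS.
rewrite ler_pM2l ?invr_gt0// opprD addrACA subrr addr0.
case: (child_eq0 s) => h; rewrite !(coord_off _ h).
  by rewrite !add0r.
by rewrite !addr0.
Qed.

(** Where [core s] is positive, so are the cores of all ancestors, and the digits along [s] are
    exact: [w] is 1 at a digit [true], and at a digit [false] the disjoint sibling contributes 0. *)
Lemma coord_core n s : 0 < f (core s) ->
  f (coord (size s + n) [::]) = dyadic s + 2^-1 ^+ size s * f (coord n s).
Proof.
elim: s n => [|i s ih] n hs; first by rewrite add0r expr0 mul1r.
have gs : 0 < f (g (i :: s)) by apply: lt_le_trans hs (core_le _).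
rewrite addSnnS ih; last by apply: lt_le_trans gs (child_le _ _).
rewrite coordS /= exprS -[RHS]addrA.
congr (_ + _); case: i hs gs => hs gs.
  have f0 : f (g (false :: s)) = 0 by case: (child_eq0 s) => // h; rewrite h ltxx in gs.
  rewrite (coord_off n f0) (w_eq1 hs) addr0 (_ : true%:R = 1)//.
  by ring.
have f0 : f (g (true :: s)) = 0 by case: (child_eq0 s) => // h; rewrite h ltxx in gs.
by rewrite (coord_off n f0) (w_eq0 f0) addr0 add0r mul0r add0r; ring.
Qed.

End Pointwise.

Lemma dyadic_dense (r : R) n : 0 <= r <= 1 ->
  exists2 s, size s = n & `|r - dyadic s| <= 2^-1 ^+ n.
Proof.
move=> /andP[r0 r1].
suff [s sn /andP[h1 h2]] : exists2 s, size s = n & 0 <= r - dyadic s <= 2^-1 ^+ n.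
  by exists s => //; rewrite ger0_norm.
elim: n => [|n [s sn /andP[h1 h2]]]; first by exists [::]; rewrite //= subr0 r0 expr0.
have [h|h] := leP (r - dyadic s) (2^-1 ^+ n.+1).
  by exists (false :: s); rewrite /= ?sn// mul0r addr0 h1.
exists (true :: s); rewrite /= ?sn// mul1r.
rewrite exprS in h *; apply/andP; split; lra.
Qed.

Lemma coordinate : exists x : V, forall f, lattice_functional f -> f E = 1 ->
  0 <= f x <= 1 /\
  forall s, 0 < f (core s) -> `|f x - dyadic s| <= 2 * 2^-1 ^+ size s.
Proof.
have uP : order_unit E by rewrite EE; exact: order_unitZ (ideal_order_unit e0).
have uA : archimedean_unit E.
  by rewrite EE; exact: (archimedean_unitZ k0 (@ideal_archimedean _ _ _ e0)).
have [||x xP] := @ideal_cvg _ _ _ e0 (fun n => coord n [::]) k; first exact: ltW.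
  move=> n; rewrite mulrC -scalerA -EE; apply: (vle_pointwise uP uA) => f fP fE.
  rewrite (latf_modulus fP) (latfB fP) (latfZ fP _ E) fE mulr1.
  exact: coord_step.
(* Truncation to [[0, 1]] does not increase the distance to [dyadic s]: wherever [core s] is
   positive, this number is a value of [coord] and lies in [[0, 1]]. *)
exists (vjoin 0 (vmeet x E)) => f fP fE; rewrite !(latfE fP) fE; split.
  by rewrite le_max lexx /= ge_max ler01 ge_min lexx orbT.
move=> s hs; have := latf_le fP (xP (size s)).
rewrite mulrAC -scalerA -EE (latf_modulus fP) (latfB fP) (latfZ fP _ E) fE mulr1.
have := coord_core fP fE 0 hs; rewrite addn0 [coord 0 s]/= (latf0 fP) mulr0 addr0 => cE.
have /andP[] := coord_itv fP fE (size s) [::]; rewrite cE.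
move: (f x) (dyadic s) (_ * _) => x' D q D0 D1; rewrite !ler_norml => /andP[h1 h2].
by case: (leP x' 1) => hx; [case: (leP 0 x') | case: (leP 0 1)] => ?;
  apply/andP; split; lra.
Qed.

End Coordinate.
End DyadicTree.

(** * Functional calculus *)

Section UniformContinuity.
Variable R : realType.
Local Notation I := (unit_itv R).
Local Notation C := (C01 R).

Lemma val_itv (p : I) : 0 <= (val p : R) <= 1.
Proof. by have := valP p; rewrite inE /= in_itv. Qed.

Definition point_of (r : R) : I := xget (unit_itv_nonempty R) [set p | val p = r].

Lemma val_point_of (r : R) : 0 <= r <= 1 -> val (point_of r) = r.
Proof.
move=> r01; rewrite /point_of; case: xgetP => [p -> //|h].
have h' : r \in (`[0, 1]%classic : set R) by rewrite inE /= in_itv.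
by case: (h (SigSub h')).
Qed.

(** Heine-Cantor by compactness: each [x] contributes half of its radius of continuity, so that a
    point close to a neighbour of [x] is still within the full radius. *)
Lemma C01_uniformly_continuous (h : C) (d : R) : 0 < d ->
  exists2 r : R, 0 < r & forall p q : I, `|val p - val q| < r -> `|h p - h q| <= d.
Proof.
move=> d0; set g := valL_ 0 (h : I -> R).
have gE p : g (val p) = h p.
  by have := congr1 (@^~ p) (valLK 0 (h : I -> R)); rewrite /sigL.
have cg : {within `[0, 1], continuous g}.
  by apply/subspace_valL_continuousP'; exact: C01_cts.
have local x : 0 <= x <= 1 -> exists2 r : R, 0 < r &
    forall y, 0 <= y <= 1 -> `|x - y| < r -> `|g x - g y| <= d / 2.
  move=> x01; have /subspace_continuousP/(_ x) := cg.
  rewrite /= in_itv /= x01 => /(_ isT) /cvgrPdist_le/(_ _ (divr_gt0 d0 (ltr0Sn R 1))).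
  move=> /nbhs_ballP[r /= r0 hr]; exists r => // y y01 xy.
  by apply: (hr y) => //=; rewrite in_itv.
have /compact_near_coveringP := @segment_compact R 0 1.
move=> /(_ R (0^'+) (fun r y => 0 <= y <= 1 -> forall z : R, 0 <= z <= 1 ->
  `|y - z| < r -> `|g y - g z| <= d) _) unif.
have /unif near_r : forall x : R, `[0, 1]%classic x -> \forall y \near x & r \near 0^'+,
    0 <= y <= 1 -> forall z : R, 0 <= z <= 1 -> `|y - z| < r -> `|g y - g z| <= d.
  move=> x; rewrite /= in_itv /= => x01; have [r r0 hr] := local x x01.
  have r2 : 0 < r / 2 by rewrite divr_gt0.
  exists ([set y | `|x - y| < r / 2], [set r' | r' < r / 2]).
    split => /=; last exact: nbhs_right_lt.
    by apply/nbhs_ballP; exists (r / 2) => // y; rewrite -ball_normE.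
  move=> [y r'] [/= hy hr'] y01 z z01 yz.
  have -> : g y - g z = (g x - g z) - (g x - g y) by ring.
  apply: le_trans (ler_normB _ _) _.
  have hxz : `|x - z| < r.
    have -> : x - z = (x - y) + (y - z) by ring.
    by apply: le_lt_trans (ler_normD _ _) _; lra.
  have hxy : `|x - y| < r by lra.
  by have := hr z z01 hxz; have := hr y y01 hxy; lra.
near (0 : R)^'+ => r.
exists r => [|p q pq]; first by near: r; exact: nbhs_right_gt.
have hr : `[0, 1]%classic `<=` (fun y => 0 <= y <= 1 -> forall z : R, 0 <= z <= 1 ->
    `|y - z| < r -> `|g y - g z| <= d) by near: r; exact: near_r.
rewrite -!gE.
by apply: hr => //=; rewrite ?in_itv/= ?val_itv.
Unshelve. all: by end_near.
Qed.

End UniformContinuity.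

Section Calculus.
Variables (R : realType) (X : banachLatticeType R) (e : X).
Hypothesis e0 : vle 0 e.
Local Notation V := (ideal e).
Local Notation C := (C01 R).
Variables (k : R) (E : V).
Hypothesis k0 : 0 < k.
Hypothesis EE : E = k *: ideal_unit e0.
Variable x : V.
Hypothesis x01 : forall f, lattice_functional f -> f E = 1 -> 0 <= f x <= 1.

(** McShane's Lipschitz formula over a finite grid: a maximum of [h r - L * |x - r|], which needs
    only the vector lattice operations. The fold starts from a lower bound of [h]. *)
Definition mcshane (h : C) (L : R) (l : seq R) : V :=
  foldr (fun r v => vjoin (h (point_of r) *: E - L *: modulus (x - r *: E)) v)
    (- `|h| *: E) l.

Lemma mcshane_approx (h : C) (d : R) : 0 < d -> exists v : V, forall f,
  lattice_functional f -> f E = 1 -> `|f v - h (point_of (f x))| <= d.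
Proof.
move=> d0; have d2 : 0 < d / 2 by rewrite divr_gt0.
have [r r0 hr] := C01_uniformly_continuous h d2.
have B0 : 0 <= `|h| :> R by exact: normr_ge0.
have hB p : - `|h| <= h p <= `|h| by rewrite -ler_norml; exact: C01_norm_ge.
(* With this slope, a grid point at distance at least [r] is penalized by at least twice the norm of
   [h], so its term does not exceed [h] at the current point. *)
pose L := 2 * `|h| / r.
have L0 : 0 <= L by rewrite divr_ge0 ?mulr_ge0// ltW.
(* Some grid point lies within [1 / K] of any point: there [h] changes by at most [d / 2] and the
   penalty is at most [L / K <= d / 2]. *)
have [K K0 [Kr KL]] : exists2 K : nat, (0 < K)%N & K%:R^-1 < r /\ L / K%:R <= d / 2.
  exists (Num.trunc (Num.max r^-1 (L / (d / 2)))).+1 => //; split.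
    rewrite invf_plt ?posrE ?ltr0n//; apply: le_lt_trans (truncnS_gt _).
    by rewrite le_max lexx.
  rewrite ler_pdivrMr ?ltr0n// mulrC -ler_pdivrMr//.
  by apply/ltW; apply: le_lt_trans (truncnS_gt _); rewrite le_max lexx orbT.
have KR : 0 < K%:R :> R by rewrite ltr0n.
pose l := [seq j%:R / K%:R | j <- iota 0 K.+1] : seq R.
have l01 t : t \in l -> 0 <= t <= 1.
  move=> /mapP[j]; rewrite mem_iota add0n ltnS => /= jK ->.
  by rewrite divr_ge0//= ler_pdivrMr// mul1r ler_nat.
exists (mcshane h L l) => f fP fE.
have t01 := x01 fP fE; have [t ft] : exists t, f x = t by exists (f x).
rewrite ft in t01 *.
have consE r' l' : f (mcshane h L (r' :: l')) =
    Num.max (h (point_of r') - L * `|t - r'|) (f (mcshane h L l')).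
  by rewrite !(latfE fP) fE ft !mulr1.
have low l' r' : r' \in l' -> h (point_of r') - L * `|t - r'| <= f (mcshane h L l').
  elim: l' => [//|a l' ih]; rewrite inE consE le_max => /predU1P[->|/ih ->].
    by rewrite lexx.
  by rewrite orbT.
have up l' : {subset l' <= l} -> f (mcshane h L l') <= h (point_of t) + d.
  elim: l' => [_|a l' ih al].
    rewrite (latfZ fP) fE mulr1; have /andP[? ?] := hB (point_of t); lra.
  rewrite consE ge_max ih ?andbT; last by move=> b bl; apply: al; rewrite inE bl orbT.
  have a01 : 0 <= a <= 1 by apply: l01; apply: al; rewrite inE eqxx.
  have [ta|ta] := ltP `|t - a| r.
    have := hr (point_of t) (point_of a); rewrite !val_point_of// => /(_ ta).
    rewrite ler_norml => /andP[? ?]; have : 0 <= L * `|t - a| by rewrite mulr_ge0.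
    lra.
  have : 2 * `|h| <= L * `|t - a|.
    by rewrite /L -mulrA ler_peMr ?mulr_ge0// mulrC ler_pdivlMr// mul1r.
  have /andP[? ?] := hB (point_of t); have /andP[? ?] := hB (point_of a); lra.
rewrite ler_norml; apply/andP; split; last by rewrite lerBlDr addrC; exact: up.
have /andP[t0 t1] := t01.
have tK0 : 0 <= t * K%:R by rewrite mulr_ge0// ltW.
have /andP[j1 j2] := truncn_itv tK0.
set j := Num.trunc _ in j1 j2.
have jl : j%:R / K%:R \in l.
  apply/mapP; exists j => //; rewrite mem_iota add0n ltnS /= -(ler_nat R).
  by apply: le_trans j1 _; rewrite ler_piMl// ltW.
have tj : `|t - j%:R / K%:R| <= K%:R^-1.
  have h1 : j%:R / K%:R <= t by rewrite ler_pdivrMr.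
  have h2 : t <= j%:R / K%:R + K%:R^-1.
    by rewrite -[X in _ + X]mul1r -mulrDl ler_pdivlMr// natr1 ltW.
  by rewrite ger0_norm ?subr_ge0// lerBlDl.
have := low _ _ jl.
have := hr (point_of t) (point_of (j%:R / K%:R)).
rewrite (val_point_of t01) (val_point_of (l01 _ jl)) => /(_ (le_lt_trans tj Kr)).
rewrite ler_norml => /andP[? ?].
have : L * `|t - j%:R / K%:R| <= d / 2.
  by apply: le_trans KL; rewrite ler_wpM2l.
lra.
Qed.

Lemma calculus (h : C) : exists v : V, forall f,
  lattice_functional f -> f E = 1 -> f v = h (point_of (f x)).
Proof. by apply: (pointwise_complete k0 EE) => d; exact: mcshane_approx. Qed.

End Calculus.

(** * The lattice embedding *)

Lemma bounded_below_isomorphism (R : realType) (X Y : normedModType R)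
    (T : {linear X -> Y}) (c : R) : 0 < c ->
  (forall x, c * `|x| <= `|T x|) -> isomorphism_onto_range T.
Proof.
move=> c0 Tc.
have Tinj : injective T.
  move=> x y Txy; apply/eqP; rewrite -subr_eq0 -normr_le0.
  have T0 : T (x - y) = 0 by rewrite linearB Txy subrr.
  by have := Tc (x - y); rewrite T0 normr0 pmulr_rle0.
have TK : cancel T (fun y => xget 0 [set x | T x = y]).
  by move=> x; case: xgetP => [z _ /= /Tinj //|/(_ x)]; case.
exists (fun y => xget 0 [set x | T x = y]) => //.
exists c^-1 => _ [x _ <-]; rewrite TK.
by rewrite mulrC ler_pdivlMr// mulrC.
Qed.

Section LatticeEmbedding.
Variables (R : realType) (X : banachLatticeType R) (e : X).
Hypothesis e0 : vle 0 e.
Local Notation V := (ideal e).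
Local Notation C := (C01 R).
Variables (k : R) (E x : V) (core : seq bool -> V) (c : R).
Hypotheses (k0 : 0 < k) (EE : E = k *: ideal_unit e0).
Hypothesis x01 : forall f, lattice_functional f -> f E = 1 -> 0 <= f x <= 1.
Hypothesis x_core : forall f, lattice_functional f -> f E = 1 ->
  forall s, 0 < f (core s) -> `|f x - dyadic R s| <= 2 * 2^-1 ^+ size s.
Hypotheses (core_ge0 : forall s, vle 0 (core s)) (core_le : forall s, vle (core s) E).
Hypotheses (c0 : 0 < c) (core_norm : forall s, c <= `|val (core s)|).

(** The algebraic identities and the upper bound hold pointwise. For the lower bound, let
    [dyadic R s] be close to a point [p]: on the support of [core s] the coordinate is close to [p],
    so [core s] scaled by [|h p| - d] lies below the modulus of [v h], and [core s] has norm at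
    least [c]. *)
Lemma lattice_embeddable_of_core : lattice_embeddable (C01 R) X.
Proof.
have /choice[v vP] := calculus k0 EE x01.
have uP : order_unit E by rewrite EE; exact: order_unitZ (ideal_order_unit e0).
have uA : archimedean_unit E.
  by rewrite EE; exact: (archimedean_unitZ k0 (@ideal_archimedean _ _ _ e0)).
have v_lin (a : R) (g h : C) : v (a *: g + h) = a *: v g + v h.
  by apply: (veq_pointwise uP uA) => f fP fE; rewrite !(latfE fP) !vP.
pose S h : X := val (v h).
have S_lin : linear S.
  by move=> a g h; rewrite /S v_lin.
pose mS := GRing.isLinear.Build R C X *:%R S S_lin.
pose T : {linear C -> X} := HB.pack S mS.
have TE h : T h = val (v h) by [].
have v_le h : vle (modulus (v h)) (`|h| *: E).
  apply: (vle_pointwise uP uA) => f fP fE; rewrite !(latfE fP) fE mulr1 vP//.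
  exact: C01_norm_ge.
exists T; split.
- exists `|val E| => h; rewrite TE mulrC.
  have := norm_le_modulus (v_le h).
  by rewrite val_idealZ normrZ ger0_norm.
- apply: (bounded_below_isomorphism c0) => h; rewrite TE.
  rewrite mulrC -ler_pdivlMr//; apply: C01_norm_le => p; rewrite ler_pdivlMr//.
  rewrite mulrC -ler_pdivlMl// mulrC; apply/ler_addgt0Pr => d d0.
  have [b0|b0] := leP (`|h p| - d) 0.
    by rewrite -lerBlDr (le_trans b0)// divr_ge0// ltW.
  have [r r0 hr] := C01_uniformly_continuous h d0.
  (* One part of [2^-1 ^+ n] from [p] to [dyadic R s], two from there to [f x]. *)
  have [n nr] := geometric_lt 3 r0.
  have [s sn ps] := dyadic_dense n (val_itv p).
  have : vle (modulus ((`|h p| - d) *: core s)) (modulus (v h)).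
    rewrite modulus_id; last by rewrite vscaler_ge0// ltW.
    apply: (vle_pointwise uP uA) => f fP fE; rewrite !(latfE fP) vP//.
    have := latf_ge0 fP (core_ge0 s); rewrite le_eqVlt => /predU1P[<-|cs].
      by rewrite mulr0.
    apply: (@le_trans _ _ (`|h p| - d)).
      have := latf_le fP (core_le s); rewrite fE => c1.
      by rewrite ler_piMr// ltW.
    have := x_core fP fE cs; rewrite sn => xs.
    have pf : `|val p - val (point_of (f x))| < r.
      rewrite val_point_of; last exact: x01.
      have -> : val p - f x = (val p - dyadic R s) - (f x - dyadic R s) by ring.
      apply: le_lt_trans (ler_normB _ _) _; lra.
    by have := hr _ _ pf; have := lerB_dist (h p) (h (point_of (f x))); lra.
  rewrite -val_vle => /le_norm_modulus.
  rewrite val_idealZ normrZ gtr0_norm// => le_v.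
  rewrite -lerBlDr ler_pdivlMr//; apply: le_trans le_v.
  by rewrite ler_wpM2l// ltW.
- split=> g h; rewrite !TE.
    by rewrite -val_vjoin; congr val; apply: (veq_pointwise uP uA) => f fP fE;
      rewrite !(latfE fP) !vP.
  by rewrite -val_vmeet; congr val; apply: (veq_pointwise uP uA) => f fP fE;
    rewrite !(latfE fP) !vP.
Qed.

End LatticeEmbedding.

Theorem theoremA (R : realType) (X : banachLatticeType R) :
  linearly_embeddable (C01 R) X <-> lattice_embeddable (C01 R) X.
Proof.
split=> [|[T [TM Tiso _]]]; last by exists T.
move=> [T [[M0 TM0] [S TS [M1 SM1]]]].
(* The given constants [M0] and [M1] carry no sign; absolute values, and the added 1 in [m], make
   [M] nonnegative and [m] positive. *)
pose M := `|M0|; have TM f : `|T f| <= M * `|f|.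
  by apply: le_trans (TM0 f) _; rewrite ler_wpM2r// ler_norm.
pose m := (`|M1| + 1)^-1; have m0 : 0 < m by rewrite invr_gt0 ltr_pwDr.
have Tm f : m * `|f| <= `|T f|.
  rewrite ler_pdivrMl ?ltr_pwDr//.
  have : `|S (T f)| <= M1 * `|T f| by apply: SM1; exists f.
  rewrite TS => /le_trans; apply; rewrite ler_wpM2r//.
  by apply: le_trans (ler_norm _) _; rewrite lerDl.
(* An enumeration of all words; indices that encode no word merely repeat the root. *)
pose z n := modulus (T (bump R (odflt [::] (unpickle n)))).
have [e e0 ze] := dominating_element (fun n => modulus_ge0 _ : vle 0 (z n)).
have /choice[y yT] : forall s, exists v : ideal e, val v = T (bump R s).
  move=> s; have [c zc] := ze (pickle s); rewrite /z pickleK /= in zc.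
  have Te : T (bump R s) \in ideal_pred e by apply/asboolP; exists c.
  by exists (exist (fun x : X => x \in ideal_pred e) _ Te : ideal e).
have yM_increments t i n : {homo i : j k / (j <= k)%N} ->
  `|val (sgnavg [seq y (prefix_of t (i k.+1)) - y (prefix_of t (i k))
     | k <- index_iota 0 n] 0)| <= M.
  move=> ihomo; rewrite val_sgnavg -map_comp.
  rewrite (_ : map _ _ = map T [seq bump R (prefix_of t (i k.+1)) -
      bump R (prefix_of t (i k)) | k <- index_iota 0 n]); last first.
    rewrite -map_comp; apply: eq_map => k.
    by rewrite [RHS]linearB -!yT.
  rewrite (_ : val (0 : ideal e) = T 0); last by rewrite linear0.
  apply: norm_sgnavg => //; first exact: normr_ge0.
  by move=> p; rewrite normr0 add0r big_map; exact: sum_bump_increments.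
have yM_level l n : uniq l -> (forall r, r \in l -> size r = n) ->
  `|val (sgnavg (map y l) 0)| <= M.
  move=> ul ln; rewrite val_sgnavg -map_comp.
  rewrite (_ : map _ _ = map T [seq bump R r | r <- l]); last first.
    by rewrite -map_comp; apply: eq_map => r; exact: yT.
  rewrite (_ : val (0 : ideal e) = T 0); last by rewrite linear0.
  apply: norm_sgnavg => //; first exact: normr_ge0.
  move=> p; rewrite normr0 add0r big_map.
  under eq_bigr do rewrite ger0_norm ?bump_ge0//.
  exact: sum_bump_disjoint ln.
have /choice[s sP] := fun t => norming_functional t m0 Tm yT.
have sdom t := (sP t).1; have sm t := (sP t).2.
have [k k0 kbig] := big_unit e0 yM_increments sdom m0 sm.
pose E := k *: ideal_unit e0; have EE : E = k *: ideal_unit e0 by [].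
have cutP h : vle 0 h -> big y s m h -> exists2 d, 0 < d & big y s m (cut E h d).
  exact: (big_cut sdom k0 EE).
have splitP h := big_split yM_increments yM_level sdom k0 EE (m := m) (h := h).
have [a [a_node a_child a_disj]] := tree_exists k0 EE cutP splitP kbig.
have [x xP] := coordinate k0 EE a_node a_child a_disj.
apply: (@lattice_embeddable_of_core _ _ _ e0 k E x (fun r => cut E (a r).1 (a r).2)
  (m / 4)) => //.
- by move=> f fP fE; case: (xP f fP fE).
- by move=> f fP fE; case: (xP f fP fE).
- by move=> r; exact: cut_ge0.
- move=> r; have [a0 aE d0 _] := a_node r; apply: vle_trans aE.
  exact: (cut_le k0 EE a0 (ltW d0)).
- by rewrite divr_gt0.
- move=> r; have [_ _ _ ab] := a_node r.
  by apply: (big_norm sdom ab).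
Qed.
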